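(* For a prime $p\ge5$ and $2p\le k\le 3p-1$, in $\mathbf F_p$, $$W_k=\begin{cases}\dfrac{(k-2p)(k-2p+1)}{2(k-2p+2)}\,B_{3p-2-k},&2p\le k\le 3p-3,\\[8pt] -\dfrac32,&k=3p-2,\\[6pt] 0,&k=3p-1.\end{cases}$$ For $p=3$ the same displayed values hold in $\mathbf F_3$.
   Context: For an odd prime $p$, the Artin--Hasse exponential is $\operatorname{AH}_p(X)=\exp\left(\sum_{i\ge0}X^{p^i}/p^i\right)=\sum_{n\ge0}u_nX^n\in\mathbf Z_p[[X]]$, $a_n\in\mathbf F_p$ is the reduction of $u_n$ modulo $p$, and $W_k=\sum_{r=0}^k(-1)^r r\,a_{rp}a_{(k-r)p}\in\mathbf F_p$. $B_n$ are the Bernoulli numbers with $B_1=-1/2$, reduced modulo $p$ (they are $p$-integral for $1\le n\le p-2$). *)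

(* Defs.v *)
From mathcomp Require Import all_boot all_order all_algebra.
Set Implicit Arguments.
Unset Strict Implicit.
Unset Printing Implicit Defensive.
Import GRing.Theory.
Local Open Scope ring_scope.

(* A formal power series over rat is its sequence of coefficients. *)
Definition fps := nat -> rat.

Definition fps_one : fps := fun n => (n == 0%N)%:R.

Definition fps_mul (f g : fps) : fps :=
  fun n => \sum_(i < n.+1) f i * g (n - i)%N.

Definition fps_pow (f : fps) (m : nat) : fps := iter m (fps_mul f) fps_one.

(* exp(f) = sum_(m >= 0) f^m / m!, for f with zero constant term: f^m is then
   divisible by X^m, so only the terms m <= n contribute to X^n. *)
Definition fps_exp (f : fps) : fps :=
  fun n => \sum_(m < n.+1) fps_pow f m n / (m`!)%:R.

(* sum_(i >= 0) X^(p^i) / p^i.  For p > 1, p^i = n forces i < n, so the bound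
   on i loses nothing. *)
Definition AH_log (p : nat) : fps :=
  fun n => \sum_(i < n.+1 | (p ^ i == n)%N) ((p ^ i)%:R)^-1.

Definition AH (p : nat) : fps := fps_exp (AH_log p).

(* For p prime, ratr x is (numerator of x) / (denominator of x) computed in
   'F_p; on p-integral rationals this is reduction modulo p. *)
Definition redp (p : nat) (x : rat) : 'F_p := ratr x.

Definition AH_coef (p n : nat) : 'F_p := redp p (AH p n).

Definition W (p k : nat) : 'F_p :=
  \sum_(r < k.+1)
    (-1) ^+ r * r%:R * AH_coef p (r * p) * AH_coef p ((k - r) * p).

(* The sequence [:: B_0; ...; B_n], from B_0 = 1 and
   sum_(j <= m) C(m+1, j) B_j = 0 for m >= 1; this gives B_1 = -1/2. *)
Fixpoint bernoulli_seq (n : nat) : seq rat :=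
  if n is m.+1 then
    let s := bernoulli_seq m in
    rcons s (- (\sum_(j < n) 'C(n.+1, j)%:R * s`_j) / n.+1%:R)
  else [:: 1].

Definition bernoulli (n : nat) : rat := (bernoulli_seq n)`_n.

Lemma size_bernoulli_seq n : size (bernoulli_seq n) = n.+1.
Proof. by elim: n => //= n IHn; rewrite size_rcons IHn. Qed.

Lemma nth_bernoulli_seq n j :
  (j <= n)%N -> (bernoulli_seq n)`_j = bernoulli j.
Proof.
elim: n => [|n IHn]; first by rewrite leqn0 => /eqP->.
rewrite leq_eqVlt => /predU1P[-> //|lt_jn].
by rewrite /= nth_rcons size_bernoulli_seq lt_jn IHn.
Qed.

Lemma bernoulli_rec n :
  \sum_(j < n.+1) 'C(n.+1, j)%:R * bernoulli j = (n == 0%N)%:R.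
Proof.
case: n => [|n]; first by rewrite big_ord1 bin0 mul1r.
rewrite big_ord_recr /= binSn {2}/bernoulli /=.
rewrite nth_rcons size_bernoulli_seq ltnn eqxx mulrC.
rewrite divfK ?Num.Theory.pnatr_eq0 //.
apply/eqP; rewrite subr_eq0; apply/eqP/eq_bigr => j _.
by rewrite nth_bernoulli_seq // -ltnS.
Qed.

Lemma bernoulli1 : bernoulli 1 = - (2%:R)^-1.
Proof.
have := bernoulli_rec 1; rewrite big_ord_recr big_ord1 /= bin0 bin1 mul1r.
have -> : bernoulli 0 = 1 by [].
move/eqP; rewrite addrC addr_eq0 => /eqP e.
by apply: (@mulfI _ (2%:R : rat)) => //; rewrite e mulrN mulfV.
Qed.

(* Main.v *)
Require Import Defs.
From HB Require Import structures.
From mathcomp Require Import all_boot all_order all_algebra all_field.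
From mathcomp Require Import boolp zify ring.
Set Implicit Arguments.
Unset Strict Implicit.
Unset Printing Implicit Defensive.
Import GRing.Theory.
Local Open Scope ring_scope.

(** Write [u n] for the coefficients of the Artin-Hasse exponential [AH (X)],
    [theta] for the derivation [f => X f'], [t] for [\sum_i X^(p^i)], and put
    [Y = X^p].  Everything is extracted from [theta AH = t AH].

    Splitting the exponents of [AH] by their residue [s] modulo [p] gives series
    [U s (Y)], and the equation becomes a cyclic system of order one
    [(s + p theta) U s = U (s - 1) + t U s] in the variable [Y]
    ([ODE_blockS], [ODE_block0]; the same letter [t] is the same series in [Y],
    because [t (X) = X + t (X^p)]).  Composing the [p] equations eliminates all
    but [U 0], and yields a product of the operators [t + s - p theta] for
    [s < p] which maps [U 0] to [- Y (U 0)].  By Fermat this product is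
    multiplication by [t^p - t = - Y] modulo [p], which says nothing on [U 0];
    but over the p-integral rationals it may be expanded modulo [p^2]
    ([shifted_block_expansion]), and the equation may then be divided by [p].
    What is left modulo [p] is [theta A = Q A], where [A] is the reduction of [U 0]
    and [Q] is an explicit series ([theta_A]): with the polynomial [K] such that
    [(X + 1) ... (X + p - 1) = X^(p-1) - 1 + p K] and the divided power [S] with
    [t^p - t + Y = p S], one has [Q = - (S + t K (t))].

    By definition [W p k] is the coefficient of [Y^k] in the product of
    [theta A] at [- Y] by [A (Y)], that is, in [Q (- Y) A (- Y) A (Y)].
    The factor [A (Y) A (- Y)] comes from [AH (X) AH (- X) = 1], where the
    coefficients of the powers of [X^p] involve all the [U s]; modulo [p] these
    are multiples of [U (p - 1)] by polynomials in [t], and one finds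
    [A (Y) A (- Y) = 1 - t^(p-1)] ([norm_block0]).  Since
    [Y = t - t^p = t (1 - t^(p-1))], the product is
    [Y K (- t) - (1 - t^(p-1)) S (- Y)].  For the [k] of the theorem a single
    power of [t] contributes to the coefficient of [Y^k] in the first summand,
    by a binomial coefficient times a coefficient of [K]; the second summand
    gives the exceptional value at [k = 3 p - 2] ([W_formula]).

    The coefficients of [K] are Bernoulli numbers modulo [p]: comparing
    [(X + 1) ... (X + p)] to the translate of [X (X + 1) ... (X + p - 1)] shows
    that they satisfy, up to scaling, the recursion of the Bernoulli numbers
    ([scaled_coef_rec], [bernoulli_reduces]).

    The integrality of the [u n] needed to speak of all this is Dwork's
    argument ([AH_Dwork], [AH_locint]). *)

(** * Formal power series *)

(** An alias of [nat -> R], so that the product is the Cauchy product rather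
    than a pointwise one. *)
Definition series (R : Type) := nat -> R.

HB.instance Definition _ (R : Type) := gen_eqMixin (series R).
HB.instance Definition _ (R : Type) := gen_choiceMixin (series R).

Section SeriesRing.
Variable R : comNzRingType.
Implicit Types f g h : series R.

Definition sadd f g : series R := fun n => f n + g n.
Definition sopp f : series R := fun n => - f n.
Definition szero : series R := fun=> 0.
Definition sone : series R := fun n => (n == 0%N)%:R.
Definition smul f g : series R := fun n => \sum_(i < n.+1) f i * g (n - i)%N.

Lemma saddA : associative sadd.
Proof. by move=> f g h; apply/funext => n; exact: addrA. Qed.

Lemma saddC : commutative sadd.
Proof. by move=> f g; apply/funext => n; exact: addrC. Qed.

Lemma sadd0 : left_id szero sadd.
Proof. by move=> f; apply/funext => n; exact: add0r. Qed.

Lemma saddN : left_inverse szero sopp sadd.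
Proof. by move=> f; apply/funext => n; exact: addNr. Qed.

HB.instance Definition _ :=
  GRing.isZmodule.Build (series R) saddA saddC sadd0 saddN.

Definition trunc_poly N f : {poly R} := \poly_(i < N) f i.

(** A coefficient of a product only involves coefficients of lower or equal
    index, so that the ring laws of series follow from those of polynomials. *)
Lemma smul_trunc N f g n : (n < N)%N ->
  smul f g n = (trunc_poly N f * trunc_poly N g)`_n.
Proof.
move=> ltnN; rewrite coefM; apply: eq_bigr => i _; rewrite !coef_poly.
by rewrite !ifT //; have := ltn_ord i; lia.
Qed.

Lemma smulC : commutative smul.
Proof.
by move=> f g; apply/funext => n; rewrite !(smul_trunc _ _ (ltnSn n)) mulrC.
Qed.

Lemma coef_mul_eq (p q p' q' : {poly R}) n :
    (forall i, (i <= n)%N -> p`_i = p'`_i) ->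
    (forall i, (i <= n)%N -> q`_i = q'`_i) ->
  (p * q)`_n = (p' * q')`_n.
Proof.
move=> ep eq; rewrite !coefM; apply: eq_bigr => i _.
by rewrite ep ?eq // ?leq_subr //; have := ltn_ord i; lia.
Qed.

Lemma smulA : associative smul.
Proof.
move=> f g h; apply/funext => n; rewrite !(smul_trunc _ _ (ltnSn n)).
have tr u v i : (i <= n)%N ->
    (trunc_poly n.+1 (smul u v))`_i = (trunc_poly n.+1 u * trunc_poly n.+1 v)`_i.
  by move=> lein; rewrite coef_poly ltnS lein (@smul_trunc n.+1).
rewrite (coef_mul_eq (fun i _ => erefl) (tr g h)) mulrA.
by rewrite -(coef_mul_eq (tr f g) (fun i _ => erefl)).
Qed.

Lemma smul1 : left_id sone smul.
Proof.
move=> f; apply/funext => n; rewrite /smul big_ord_recl big1 => [|i _].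
  by rewrite /sone mul1r addr0 subn0.
by rewrite /sone mul0r.
Qed.

Lemma smulDl : left_distributive smul sadd.
Proof.
move=> f g h; apply/funext => n; rewrite /smul /sadd -big_split.
by apply: eq_bigr => i _; rewrite mulrDl.
Qed.

Lemma sone_neq0 : sone != 0.
Proof.
apply/eqP => /(congr1 (fun f : series R => f 0%N)) /eqP.
by rewrite /sone oner_eq0.
Qed.

HB.instance Definition _ :=
  GRing.Zmodule_isComNzRing.Build (series R) smulA smulC smul1 smulDl sone_neq0.

Lemma sDE f g n : (f + g) n = f n + g n. Proof. by []. Qed.
Lemma sNE f n : (- f) n = - f n. Proof. by []. Qed.
Lemma s1E n : (1 : series R) n = (n == 0%N)%:R. Proof. by []. Qed.
Lemma sME f g n : (f * g) n = \sum_(i < n.+1) f i * g (n - i)%N.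
Proof. by []. Qed.

Lemma sumsE (I : Type) (r : seq I) (P : pred I) (F : I -> series R) n :
  (\sum_(i <- r | P i) F i) n = \sum_(i <- r | P i) F i n.
Proof. by elim/big_rec2: _ => // i x y _ <-. Qed.

Lemma smulrnE f m n : (f *+ m) n = f n *+ m.
Proof. by elim: m => [|m IHm]; rewrite ?mulr0n // !mulrS sDE IHm. Qed.

Lemma smul_natE m f n : (m%:R * f) n = m%:R * f n.
Proof. by rewrite !mulr_natl smulrnE. Qed.

Lemma sM0E f g : (f * g) 0%N = f 0%N * g 0%N.
Proof. by rewrite sME big_ord1 subn0. Qed.

Lemma sX0E f m : (f ^+ m) 0%N = f 0%N ^+ m.
Proof. by elim: m => [|m IHm]; rewrite ?expr0 // !exprS sM0E IHm. Qed.

(** ** Truncated equality *)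

Definition eq_below N f g := forall n, (n < N)%N -> f n = g n.

Lemma eq_belowM N f f' g g' :
  eq_below N f f' -> eq_below N g g' -> eq_below N (f * g) (f' * g').
Proof.
move=> ef eg n ltnN; rewrite !sME; apply: eq_bigr => i _.
by rewrite ef ?eg //; have := ltn_ord i; lia.
Qed.

Lemma eq_below_trunc N f g (p q : {poly R}) :
    eq_below N f (fun n => p`_n) -> eq_below N g (fun n => q`_n) ->
  eq_below N (f * g) (fun n => (p * q)`_n).
Proof.
by move=> ef eg n ltnN; rewrite (eq_belowM ef eg ltnN) coefM.
Qed.

Lemma eq_below_truncX N f m :
  eq_below N (f ^+ m) (fun n => (trunc_poly N f ^+ m)`_n).
Proof.
elim: m => [|m IHm]; first by move=> n _; rewrite !expr0 coef1.
rewrite !exprS; apply: eq_below_trunc => // n ltnN.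
by rewrite coef_poly ltnN.
Qed.

(** ** Monomials *)

Definition mon k : series R := fun n => (n == k)%:R.

Lemma monME k f n : (mon k * f) n = if (k <= n)%N then f (n - k)%N else 0.
Proof.
rewrite sME; case: leqP => [lekn | ltnk].
  rewrite (bigD1 (Ordinal (lekn : (k < n.+1)%N))) //= /mon eqxx mul1r big1.
    by rewrite addr0.
  move=> i; rewrite -val_eqE /= => /negPf->; exact: mul0r.
rewrite big1 // => i _; rewrite /mon; case: eqP => [e|]; last by rewrite mul0r.
by have := ltn_ord i; lia.
Qed.

Lemma mon0 : mon 0 = 1. Proof. by []. Qed.

Lemma monD k l : mon (k + l)%N = mon k * mon l.
Proof.
apply/funext => n; rewrite monME /mon; case: leqP => [lekn|ltnk].
  by congr (nat_of_bool _)%:R; lia.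
by case: eqP => //; lia.
Qed.

Lemma monX k m : mon k ^+ m = mon (m * k)%N.
Proof. by elim: m => // m IHm; rewrite exprS IHm mulSn monD. Qed.

(** ** The Euler derivation and the change of sign of the variable *)

Definition theta f : series R := fun n => n%:R * f n.

Lemma thetaD f g : theta (f + g) = theta f + theta g.
Proof. by apply/funext => n; exact: mulrDr. Qed.

Lemma thetaN f : theta (- f) = - theta f.
Proof. by apply/funext => n; exact: mulrN. Qed.

Lemma theta0 : theta 0 = 0.
Proof. by apply/funext => n; exact: mulr0. Qed.

Lemma theta1 : theta 1 = 0.
Proof.
by apply/funext => -[|n]; rewrite /theta s1E ?mul0r // mulr0.
Qed.

Lemma thetaM f g : theta (f * g) = theta f * g + f * theta g.
Proof.
apply/funext => n; rewrite /theta sDE !sME -big_split mulr_sumr.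
apply: eq_bigr => i _ /=; have lein : (i <= n)%N by have := ltn_ord i; lia.
rewrite -{1}(subnKC lein) natrD; move: (n - i)%N => j; ring.
Qed.

Lemma theta_nat n : theta n%:R = 0.
Proof. by elim: n => [|n IHn]; rewrite ?theta0 // -natr1 thetaD IHn theta1 addr0. Qed.

Lemma theta_natM n f : theta (n%:R * f) = n%:R * theta f.
Proof. by rewrite thetaM theta_nat mul0r add0r. Qed.

Lemma thetaX f m : theta (f ^+ m.+1) = m.+1%:R * f ^+ m * theta f.
Proof.
elim: m => [|m IHm]; first by rewrite expr1 expr0 !mul1r.
by rewrite exprS thetaM IHm -[m.+2%:R]natr1 !exprS; ring.
Qed.

Lemma theta_mon k : theta (mon k) = k%:R * mon k.
Proof.
apply/funext => n; rewrite smul_natE /theta /mon.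
by case: eqP => [->|]; rewrite ?mulr0.
Qed.

Definition sneg f : series R := fun n => (-1) ^+ n * f n.

Lemma snegD f g : sneg (f + g) = sneg f + sneg g.
Proof. by apply/funext => n; exact: mulrDr. Qed.

Lemma sneg1 : sneg 1 = 1.
Proof. by apply/funext => -[|n]; rewrite /sneg s1E ?mulr1 ?mulr0. Qed.

Lemma snegN f : sneg (- f) = - sneg f.
Proof. by apply/funext => n; exact: mulrN. Qed.

Lemma snegM f g : sneg (f * g) = sneg f * sneg g.
Proof.
apply/funext => n; rewrite /sneg !sME mulr_sumr.
apply: eq_bigr => i _; have lein : (i <= n)%N by have := ltn_ord i; lia.
by rewrite -{1}(subnKC lein) exprD; ring.
Qed.

Lemma sneg_theta f : sneg (theta f) = theta (sneg f).
Proof. by apply/funext => n; rewrite /sneg /theta; ring. Qed.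

Lemma sneg_is_zmod_morphism : zmod_morphism sneg.
Proof. by move=> f g; rewrite snegD snegN. Qed.

Lemma sneg_is_monoid_morphism : monoid_morphism sneg.
Proof. by split; [exact: sneg1 | exact: snegM]. Qed.

HB.instance Definition _ :=
  GRing.isZmodMorphism.Build (series R) (series R) sneg sneg_is_zmod_morphism.
HB.instance Definition _ :=
  GRing.isMonoidMorphism.Build (series R) (series R) sneg
    sneg_is_monoid_morphism.

End SeriesRing.

(** ** Change of coefficients *)

Definition smap (R S : comNzRingType) (phi : R -> S) (f : series R) : series S :=
  fun n => phi (f n).

Section SeriesMap.
Variables (R S : comNzRingType) (phi : {rmorphism R -> S}).

Lemma smap_is_zmod_morphism : zmod_morphism (smap phi).
Proof. by move=> f g; apply/funext => n; exact: rmorphB. Qed.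

Lemma smap_is_monoid_morphism : monoid_morphism (smap phi).
Proof.
split=> [|f g]; apply/funext => n; rewrite /smap; first exact: rmorph_nat.
by rewrite !sME rmorph_sum; apply: eq_bigr => i _; exact: rmorphM.
Qed.

HB.instance Definition _ :=
  GRing.isZmodMorphism.Build (series R) (series S) (smap phi)
    smap_is_zmod_morphism.
HB.instance Definition _ :=
  GRing.isMonoidMorphism.Build (series R) (series S) (smap phi)
    smap_is_monoid_morphism.

Lemma smap_theta f : smap phi (theta f) = theta (smap phi f).
Proof. by apply/funext => n; rewrite /smap /theta rmorphM rmorph_nat. Qed.

Lemma smap_mon k : smap phi (mon R k) = mon S k.
Proof. by apply/funext => n; exact: rmorph_nat. Qed.

End SeriesMap.

(** * Sections of a series along the residues modulo [p] *)

Lemma sum_multiples (V : nmodType) p n (h : nat -> V) : (0 < p)%N ->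
  \sum_(i < n.+1 | (p %| i)%N) h i = \sum_(a < (n %/ p).+1) h (a * p)%N.
Proof.
move=> p_gt0.
rewrite (reindex_onto (fun a : 'I_(n %/ p).+1 => inord (a * p)%N : 'I_n.+1)
           (fun i => inord (i %/ p)%N)) /=; last first.
  move=> i dvd_pi; apply: val_inj => /=.
  have lt_i : (i %/ p < (n %/ p).+1)%N by rewrite ltnS leq_div2r // -ltnS.
  by rewrite (inordK lt_i) divnK // inordK.
have inK (a : 'I_(n %/ p).+1) : (inord (a * p)%N : 'I_n.+1) = (a * p)%N :> nat.
  by rewrite inordK // ltnS -leq_divRL // -ltnS.
apply: eq_big => [a|a _] /=; last by rewrite inK.
by rewrite inK dvdn_mull //= mulnK // inord_val eqxx.
Qed.

Section Blocks.
Variables (R : comNzRingType) (p : nat).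
Hypothesis p_gt0 : (0 < p)%N.
Implicit Types f g : series R.

(** The substitution of [X^p] for [X]. *)
Definition dilate f : series R := fun n => if (p %| n)%N then f (n %/ p)%N else 0.

(** With [Y = X^p], a series is [\sum_(s < p) X^s (block s f)(Y)]. *)
Definition block s f : series R := fun r => f (r * p + s)%N.

Lemma dilateE f n : dilate f (n * p)%N = f n.
Proof. by rewrite /dilate dvdn_mull // mulnK. Qed.

Lemma blockD s f g : block s (f + g) = block s f + block s g.
Proof. by []. Qed.

Lemma block_sum s I (r : seq I) (P : pred I) (F : I -> series R) :
  block s (\sum_(i <- r | P i) F i) = \sum_(i <- r | P i) block s (F i).
Proof. by apply/funext => n; rewrite /block !sumsE. Qed.

(** A series in [X^p] is a scalar for the splitting into blocks. *)
Lemma block_dilateM s f g : (s < p)%N ->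
  block s (dilate f * g) = f * block s g.
Proof.
move=> lt_sp; apply/funext => r; rewrite /block !sME.
pose h i := f (i %/ p)%N * g (r * p + s - i)%N.
transitivity (\sum_(i < (r * p + s).+1 | (p %| i)%N) h i).
  rewrite [RHS]big_mkcond; apply: eq_bigr => i _; rewrite /dilate /h.
  by case: ifP; rewrite ?mul0r.
rewrite sum_multiples // divnMDl // divn_small // addn0; apply: eq_bigr => a _.
rewrite /h mulnK // mulnBl addnBAC // leq_mul2r.
by have := ltn_ord a; lia.
Qed.

Lemma dilateM f g : dilate (f * g) = dilate f * dilate g.
Proof.
apply/funext => n; rewrite {1}/dilate; case: ifP => [/dvdnP[r ->]|p_ndvd_n].
  rewrite mulnK // -[RHS]/((dilate f * dilate g) (r * p)%N) -[(r * p)%N]addn0.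
  rewrite -[RHS]/(block 0 (dilate f * dilate g) r) block_dilateM //.
  by congr ((f * _) r); apply/funext => i; rewrite /block addn0 dilateE.
rewrite sME big1 // => i _; rewrite /dilate.
case: ifP => [p_dvd_i|]; last by rewrite mul0r.
case: ifP => [p_dvd_ni|]; last by rewrite mulr0.
have le_in : (i <= n)%N by have := ltn_ord i; lia.
by rewrite -(subnKC le_in) dvdn_addr // p_dvd_ni in p_ndvd_n.
Qed.

Lemma theta_dilate f : theta (dilate f) = p%:R * dilate (theta f).
Proof.
apply/funext => n; rewrite smul_natE /theta /dilate.
case: ifP => [/dvdnP[r ->]|_]; last by rewrite !mulr0.
by rewrite mulnK // natrM; ring.
Qed.

Lemma block_theta s f :
  block s (theta f) = s%:R * block s f + p%:R * theta (block s f).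
Proof.
apply/funext => r; rewrite sDE !smul_natE /block /theta natrD natrM.
by move: (f _) => x; ring.
Qed.

Lemma block_mon0 k f : (0 < k < p)%N ->
  block 0 (mon R k * f) = mon R 1 * block (p - k) f.
Proof.
move=> /andP[k_gt0 lt_kp]; apply/funext => -[|r]; rewrite /block !monME.
  by rewrite ifF //; lia.
rewrite ifT; last by nia.
by rewrite subn1 /=; congr f; nia.
Qed.

Lemma block_monS s f : block s.+1 (mon R 1 * f) = block s f.
Proof. by apply/funext => r; rewrite /block monME addnS subn1. Qed.

Lemma block_decomp f : f = \sum_(s < p) dilate (block s f) * mon R s.
Proof.
apply/funext => n; rewrite sumsE.
rewrite (bigD1 (Ordinal (ltn_pmod n p_gt0))) //= big1 => [|s].
  rewrite mulrC monME leq_mod /dilate /block {1 2 4}(divn_eq n p) addnK.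
  by rewrite dvdn_mull // mulnK // -divn_eq addr0.
rewrite -val_eqE /= => /eqP ne_s; rewrite mulrC monME; case: leqP => // le_sn.
rewrite /dilate; case: ifP => // /dvdnP[q e]; case: ne_s.
by rewrite -(subnK le_sn) e modnMDl modn_small.
Qed.

(** The part of a product along the multiples of [p]: the residues of the two
    exponents are opposite, and they carry unless both vanish. *)
Lemma block0M f g :
  block 0 (f * g) = block 0 f * block 0 g
    + mon R 1 * \sum_(1 <= s < p) block s f * block (p - s) g.
Proof.
rewrite {1}(block_decomp f) mulr_suml block_sum.
rewrite -(big_mkord xpredT
  (fun s => block 0 (dilate (block s f) * mon R s * g))) big_ltn //.
rewrite -mulrA block_dilateM // mon0 mul1r; congr (_ + _).
rewrite mulr_sumr !big_nat; apply: eq_bigr => s s_int.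
by rewrite -mulrA block_dilateM // block_mon0 //; ring.
Qed.

End Blocks.

(** ** The series [\sum_i X^(p^i)] *)

Section PowerSum.
Variable R : comNzRingType.

Definition ppowers p : series R := fun n => (n == p ^ logn p n)%N%:R.

(** The self-similarity that makes the same series [t] appear again as the
    coefficient of the equations satisfied by the blocks. *)
Lemma ppowersE p : prime p ->
  ppowers p = mon R 1 + dilate p (ppowers p).
Proof.
move=> p_pr; have p_gt0 := prime_gt0 p_pr; apply/funext => n.
rewrite sDE /mon /dilate /ppowers; case: ifP => [/dvdnP[m ->]|p_ndvd_n].
  rewrite mulnK //; case: m => [|m].
    by rewrite mul0n /= logn0 expn0 addr0.
  rewrite lognM // (logn_prime p p_pr) eqxx addn1 expnSr eqn_pmul2r //.
  rewrite (_ : (m.+1 * p == 1)%N = false) ?add0r //.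
  by have := prime_gt1 p_pr; apply: contraTF => /eqP; nia.
case: n p_ndvd_n => [|n]; first by rewrite dvdn0.
move=> p_ndvd_n; rewrite addr0.
suff -> : logn p n.+1 = 0%N by rewrite expn0.
by apply/eqP; rewrite -leqn0 leqNgt -pfactor_dvdn ?expn1 ?p_ndvd_n.
Qed.

Lemma sneg_ppowers p : odd p -> sneg (ppowers p) = - ppowers p.
Proof.
move=> odd_p; apply/funext => n; rewrite /sneg /ppowers sNE.
case: eqP => [->|_]; last by rewrite mulr0 oppr0.
by rewrite -signr_odd oddX odd_p orbT mulr1 expr1.
Qed.

End PowerSum.

Lemma smap_ppowers (R S : comNzRingType) (phi : {rmorphism R -> S}) p :
  smap phi (ppowers R p) = ppowers S p.
Proof. by apply/funext => n; exact: rmorph_nat. Qed.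

(** ** Blocks of a solution of [X f' = (\sum_i X^(p^i)) f] *)

Section BlocksODE.
Variables (R : comNzRingType) (p : nat) (f : series R).
Hypothesis p_pr : prime p.
Hypothesis theta_f : theta f = ppowers R p * f.
Let t := ppowers R p.

Let p_gt0 := prime_gt0 p_pr.

Lemma ODE_blockS s : (s.+1 < p)%N ->
  s.+1%:R * block p s.+1 f + p%:R * theta (block p s.+1 f)
    = block p s f + t * block p s.+1 f.
Proof.
move=> lt_sp; rewrite -block_theta theta_f ppowersE // mulrDl blockD.
by rewrite block_monS block_dilateM.
Qed.

Lemma ODE_block0 :
  p%:R * theta (block p 0 f) = mon R 1 * block p p.-1 f + t * block p 0 f.
Proof.
have := block_theta p 0 f; rewrite mul0r add0r => <-.
rewrite theta_f ppowersE // mulrDl blockD block_dilateM // block_mon0 ?subn1 //.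
exact: prime_gt1.
Qed.

End BlocksODE.

(** ** Frobenius *)

(** The coefficients of a series over ['F_p] are fixed by Frobenius, so that
    the p-th power is the substitution [X -> X^p]. *)
Lemma series_Frobenius p (f : series 'F_p) : prime p -> f ^+ p = dilate p f.
Proof.
move=> p_pr; apply/funext => n; rewrite (eq_below_truncX f p (ltnSn n)).
have pchar_p : p \in [pchar {poly 'F_p}] by rewrite pchar_poly pchar_Fp.
rewrite /trunc_poly poly_def -(pFrobenius_autE pchar_p) rmorph_sum /=.
rewrite coef_sum /dilate.
have -> : (\sum_(i < n.+1) (pFrobenius_aut pchar_p (f i *: 'X^i))`_n)
        = \sum_(i < n.+1) f i * (n == i * p)%N%:R.
  apply: eq_bigr => i _; rewrite pFrobenius_autE exprZn -exprM coefZ coefXn.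
  by congr (_ * _); have := expf_card (f i); rewrite card_Fp.
case: ifP => [/dvdnP[m en]|p_ndvd_n]; last first.
  apply: big1 => i _; case: eqP => [en|]; last by rewrite mulr0.
  by rewrite en dvdn_mull in p_ndvd_n.
have p_gt0 := prime_gt0 p_pr.
have lt_mn : (m < n.+1)%N by nia.
rewrite (bigD1 (Ordinal lt_mn)) //= big1 => [|i].
  by rewrite en eqxx mulr1 mulnK // addr0.
rewrite -val_eqE /= => /negPf ne_im.
by rewrite {2}en eqn_pmul2r // eq_sym ne_im mulr0.
Qed.

(** * Rationals whose denominator is nonzero in a field *)

Section Localization.
Variable F : fieldType.

(** For ['F_p] these are the p-integral rationals.  Working over an arbitrary
    field makes the subring instance free of side conditions on [p]. *)
Definition locint : {pred rat} := fun x => (denq x)%:~R != 0 :> F.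

(** Any fraction representing [x], reduced or not, may be used: the reduced
    denominator divides [b]. *)
Lemma locint_frac x (a b : int) : (b%:~R != 0 :> F) ->
    x * b%:~R = a%:~R -> x \in locint /\ ratr x * b%:~R = a%:~R :> F.
Proof.
move=> nz_b e; have eZ : numq x * b = a * denq x.
  apply: (@intr_inj rat); rewrite !rmorphM /= -e numqE; ring.
have nz_d : (denq x)%:~R != 0 :> F.
  have /dvdzP[c eb] : (denq x %| b)%Z.
    rewrite -(Gauss_dvdzr b (_ : coprimez (denq x) (numq x))); last first.
      by rewrite coprimezE coprime_sym coprime_num_den.
    by rewrite eZ dvdz_mull.
  by apply: contraNneq nz_b => d0; rewrite eb rmorphM /= d0 mulr0.
split=> //; rewrite /ratr mulrAC; apply: (canLR (mulfK nz_d)).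
by rewrite -!rmorphM /= eZ.
Qed.

Lemma ratr_frac x (a b : int) : (b%:~R != 0 :> F) ->
  x * b%:~R = a%:~R -> ratr x = a%:~R / b%:~R :> F.
Proof. by move=> nz_b /(locint_frac nz_b)[_ <-]; rewrite mulfK. Qed.

Lemma locint_opB x y : x \in locint -> y \in locint ->
  x - y \in locint /\ ratr (x - y) = ratr x - ratr y :> F.
Proof.
move=> lx ly; have nz : (denq x * denq y)%:~R != 0 :> F.
  by rewrite rmorphM mulf_neq0.
have e : (x - y) * (denq x * denq y)%:~R
         = (numq x * denq y - numq y * denq x)%:~R.
  by rewrite rmorphB !rmorphM /= !numqE; ring.
split; first by case: (locint_frac nz e).
rewrite (ratr_frac nz e) /ratr rmorphB !rmorphM /=; field.
by apply/andP.
Qed.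

Lemma locint_opM x y : x \in locint -> y \in locint ->
  x * y \in locint /\ ratr (x * y) = ratr x * ratr y :> F.
Proof.
move=> lx ly; have nz : (denq x * denq y)%:~R != 0 :> F.
  by rewrite rmorphM mulf_neq0.
have e : (x * y) * (denq x * denq y)%:~R = (numq x * numq y)%:~R.
  by rewrite !rmorphM /= !numqE; ring.
split; first by case: (locint_frac nz e).
rewrite (ratr_frac nz e) /ratr !rmorphM /=; field.
by apply/andP.
Qed.

Lemma locint_nat n : n%:R \in locint /\ ratr n%:R = n%:R :> F.
Proof.
have nz : (1 : int)%:~R != 0 :> F by rewrite oner_eq0.
have e : n%:R * (1 : int)%:~R = (n%:Z)%:~R :> rat by rewrite mulr1.
by split; [case: (locint_frac nz e) | rewrite (ratr_frac nz e) divr1].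
Qed.

Lemma locint_subring_closed : subring_closed locint.
Proof.
split=> [|x y lx ly|x y lx ly]; first exact: (locint_nat 1).1.
  exact: (locint_opB lx ly).1.
exact: (locint_opM lx ly).1.
Qed.

HB.instance Definition _ :=
  GRing.isSubringClosed.Build rat locint locint_subring_closed.

Record localized := Localized { loc_val :> rat; loc_valP : loc_val \in locint }.

HB.instance Definition _ := [isSub for loc_val].
HB.instance Definition _ := [Choice of localized by <:].
HB.instance Definition _ := [SubChoice_isSubComNzRing of localized by <:].

Definition residue (x : localized) : F := ratr (val x).

Lemma residue_is_zmod_morphism : zmod_morphism residue.
Proof.
by move=> x y; rewrite /residue rmorphB (locint_opB (valP x) (valP y)).2.
Qed.

Lemma residue_is_monoid_morphism : monoid_morphism residue.
Proof.
split=> [|x y]; rewrite /residue; first by rewrite rmorph1 (locint_nat 1).2.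
by rewrite rmorphM (locint_opM (valP x) (valP y)).2.
Qed.

HB.instance Definition _ :=
  GRing.isZmodMorphism.Build localized F residue residue_is_zmod_morphism.
HB.instance Definition _ :=
  GRing.isMonoidMorphism.Build localized F residue residue_is_monoid_morphism.

End Localization.

Section LocalizedAtPrime.
Variable p : nat.
Hypothesis p_pr : prime p.
Local Notation Zp := (localized 'F_p).

Lemma natFp_eq0 n : (n%:R == 0 :> 'F_p) = (p %| n)%N.
Proof. by rewrite (dvdn_pcharf (pchar_Fp p_pr)). Qed.

Lemma intFp_eq0 n : (n%:~R == 0 :> 'F_p) = (p %| n)%Z.
Proof.
case: n => n; first by rewrite -pmulrn natFp_eq0.
by rewrite NegzE rmorphN oppr_eq0 /= -pmulrn natFp_eq0 dvdzE abszN.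
Qed.

Lemma natZp_inj n (x y : Zp) : (0 < n)%N -> n%:R * x = n%:R * y -> x = y.
Proof.
move=> n_gt0 /(congr1 val); rewrite !rmorphM !rmorph_nat => e.
by apply: val_inj; apply: mulfI e; rewrite Num.Theory.pnatr_eq0 -lt0n.
Qed.

(** The kernel of the residue map is generated by [p]: this is how congruences
    are divided by [p] below. *)
Lemma residue_eq0 (x : Zp) : residue x = 0 -> exists y : Zp, x = p%:R * y.
Proof.
move=> /eqP; have dx : (denq (val x))%:~R != 0 :> 'F_p := valP x.
rewrite /residue /ratr mulf_eq0 invr_eq0 (negPf dx) orbF intFp_eq0.
move=> /dvdzP[a ea].
have nzp : p%:R != 0 :> rat by rewrite Num.Theory.pnatr_eq0 -lt0n prime_gt0.
have e : val x / p%:R * (denq (val x))%:~R = a%:~R.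
  by rewrite mulrAC -numqE ea rmorphM /= -pmulrn mulfK.
exists (Localized (locint_frac dx e).1); apply: val_inj.
by rewrite rmorphM rmorph_nat /= mulrC divfK.
Qed.

Lemma series_residue_eq0 (f : series Zp) :
  smap (@residue 'F_p) f = 0 -> exists g, f = p%:R * g.
Proof.
move=> f0; have ex n : exists y, f n = p%:R * y.
  by apply: residue_eq0; exact: (congr1 (fun g : series _ => g n) f0).
have [g fg] := choice ex.
by exists g; apply/funext => n; rewrite smul_natE fg.
Qed.

Lemma series_natZp_inj n (f g : series Zp) : (0 < n)%N ->
  n%:R * f = n%:R * g -> f = g.
Proof.
move=> n_gt0 e; apply/funext => k; apply: (natZp_inj n_gt0).
by move/(congr1 (fun h : series Zp => h k)): e; rewrite !smul_natE.
Qed.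

End LocalizedAtPrime.

(** * The Artin-Hasse exponential *)

Lemma fps_powE (f : series rat) m : fps_pow f m = f ^+ m.
Proof. by elim: m => // m IHm; rewrite exprS -IHm. Qed.

Lemma seriesX_low (R : comNzRingType) (f : series R) m n :
  f 0%N = 0 -> (n < m)%N -> (f ^+ m) n = 0.
Proof.
move=> f0 lt_nm; have -> : f = mon R 1 * (fun n => f n.+1).
  apply/funext => -[|k]; rewrite monME //=.
  by rewrite subn1.
by rewrite exprMn monX muln1 monME leqNgt lt_nm.
Qed.

Lemma fps_expE (f : series rat) n N : f 0%N = 0 -> (n < N)%N ->
  fps_exp f n = \sum_(m < N) (f ^+ m) n / m`!%:R.
Proof.
move=> f0 lt_nN; rewrite /fps_exp (big_ord_widen _ (fun m =>
  fps_pow f m n / m`!%:R) lt_nN) [RHS](bigID (fun m : 'I_N => (m < n.+1)%N)) /=.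
rewrite [X in _ + X]big1 => [|m]; last first.
  by rewrite ltnNge negbK => lt_nm; rewrite seriesX_low ?mul0r.
by rewrite addr0; apply: eq_bigr => m _; rewrite fps_powE.
Qed.

(** The chain rule for the exponential; the sums over [m] and over the Cauchy
    product are exchanged, and the powers [f ^+ m] with [m] larger than the
    degree contribute nothing. *)
Lemma theta_exp (f : series rat) : f 0%N = 0 ->
  theta (fps_exp f : series rat) = theta f * (fps_exp f : series rat).
Proof.
move=> f0; apply/funext => n; rewrite sME /theta (fps_expE f0 (ltnSn n)).
have -> : n%:R * (\sum_(m < n.+1) (f ^+ m) n / m`!%:R)
        = \sum_(m < n) (theta f * f ^+ m) n / m`!%:R.
  rewrite big_ord_recl expr0 s1E /= mulrDr.
  have -> : n%:R * ((n == 0)%N%:R / 0`!%:R) = 0 :> rat.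
    by case: n => [|n]; rewrite !mul0r // mulr0.
  rewrite add0r mulr_sumr; apply: eq_bigr => m _ /=.
  have -> : n%:R * ((f ^+ m.+1) n / (m.+1)`!%:R)
          = theta (f ^+ m.+1) n / (m.+1)`!%:R by rewrite mulrA.
  rewrite thetaX -mulrA smul_natE factS natrM mulrC (mulrC (f ^+ m)).
  have nz k : (0 < k)%N -> k%:R != 0 :> rat.
    by rewrite Num.Theory.pnatr_eq0 lt0n.
  have := nz m.+1 isT; have := nz m`! (fact_gt0 m).
  move: (_ n) (m`!%:R) (m.+1%:R) => a b c nzb nzc; field; exact/andP.
transitivity (\sum_(m < n) \sum_(i < n.+1)
                theta f i * ((f ^+ m) (n - i)%N / m`!%:R)).
  by apply: eq_bigr => m _; rewrite sME mulr_suml; apply: eq_bigr => i _;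
    rewrite mulrA.
rewrite exchange_big; apply: eq_bigr => -[[|i] lt_in] _ /=.
  by rewrite /theta f0 mulr0 mul0r big1 // => m _; rewrite mul0r.
by rewrite -mulr_sumr (fps_expE (N := n) f0) //; lia.
Qed.

Lemma ODE_unique (c f g : series rat) : c 0%N = 0 -> f 0%N = g 0%N ->
  theta f = c * f -> theta g = c * g -> f = g.
Proof.
move=> c0 fg0 ef eg; apply/funext => n.
elim/ltn_ind: n => -[|n] IHn //.
have nz : n.+1%:R != 0 :> rat by rewrite Num.Theory.pnatr_eq0.
apply: (mulfI nz); rewrite -[LHS]/(theta f n.+1) -[RHS]/(theta g n.+1) ef eg.
rewrite !sME; apply: eq_bigr => -[[|i] lt_in] _ /=; first by rewrite c0 !mul0r.
by rewrite IHn //; lia.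
Qed.

Section ArtinHasse.
Variable p : nat.
Hypothesis p_pr : prime p.
Let p_gt0 := prime_gt0 p_pr.
Local Notation u := (AH p : series rat).

Lemma sum_ppower (V : nmodType) n (h : nat -> V) :
  \sum_(i < n.+1 | (p ^ i == n)%N) h i
    = if (n == p ^ logn p n)%N then h (logn p n) else 0.
Proof.
case: eqP => [en | ne_n]; last first.
  apply: big1 => i /eqP ei; case: ne_n.
  by rewrite -ei pfactorK.
have lt_ln : (logn p n < n.+1)%N.
  by rewrite ltnS {2}en ltnW // ltn_expl // prime_gt1.
rewrite (big_pred1 (Ordinal lt_ln)) // => i.
rewrite /= -val_eqE /=; apply/eqP/eqP => [ei|->]; last by rewrite -en.
by rewrite -[LHS](pfactorK i p_pr) ei.
Qed.

Lemma AH_log0 : AH_log p 0 = 0.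
Proof.
rewrite /AH_log (sum_ppower 0 (fun i => (p ^ i)%:R^-1)).
by case: eqP => //; rewrite logn0.
Qed.

Lemma theta_AH_log : theta (AH_log p : series rat) = ppowers rat p.
Proof.
apply/funext => n; rewrite /theta /AH_log /ppowers.
rewrite (sum_ppower n (fun i => (p ^ i)%:R^-1)).
case: eqP => [en|_]; last by rewrite mulr0.
by rewrite -en mulfV // Num.Theory.pnatr_eq0 {1}en -lt0n expn_gt0 p_gt0.
Qed.

Lemma theta_AH : theta u = ppowers rat p * u.
Proof. by rewrite /AH theta_exp ?theta_AH_log ?AH_log0. Qed.

Lemma AH0 : u 0%N = 1.
Proof. by rewrite /AH /fps_exp big_ord1 /= divr1. Qed.

End ArtinHasse.

(** ** Integrality *)

(** Legendre's formula, where each quotient [n %/ p^k] is at most half of the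
    previous one. *)
Lemma logn_fact_lt p n : prime p -> (0 < n)%N -> (logn p n`! < n)%N.
Proof.
move=> p_pr n_gt0; rewrite logn_fact // big_add1 /=.
suff: forall K m, (0 < m)%N -> (\sum_(0 <= k < K) m %/ p ^ k.+1 < m)%N by apply.
elim=> [|K IHK] {n_gt0} n n_gt0; first by rewrite big_geq.
have p_gt1 := prime_gt1 p_pr.
rewrite big_nat_recl // expn1; under eq_bigr do rewrite expnS divnMA.
case: (posnP (n %/ p)) => [-> | m_gt0].
  by rewrite big1 // => i _; rewrite div0n.
apply: leq_trans (leq_trunc_div n p); rewrite -ltnS ltnS.
apply: leq_trans (_ : (n %/ p * 2 <= _)%N); last by rewrite leq_mul2l p_gt1 orbT.
by rewrite muln2 -addnn ltn_add2l IHK.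
Qed.

(** The valuation of [(n + 1)!] is at most [n], which leaves one factor [p]. *)
Lemma pX_exp_int p n : prime p ->
  exists v : localized 'F_p, p%:R ^+ n.+1 / (n.+1)`!%:R = p%:R * val v.
Proof.
move=> p_pr; have lt_l := logn_fact_lt p_pr (ltn0Sn n).
have [m cop em] := pfactor_coprime p_pr (fact_gt0 n.+1).
set l := logn p _ in lt_l em.
have nz_m : m%:Z%:~R != 0 :> 'F_p.
  by rewrite -pmulrn natFp_eq0 // -prime_coprime.
have nzm : m%:R != 0 :> rat.
  by rewrite Num.Theory.pnatr_eq0; apply: contraNneq nz_m => ->.
have nzp : p%:R != 0 :> rat by rewrite Num.Theory.pnatr_eq0 -lt0n prime_gt0.
have e : p%:R ^+ (n - l) / m%:R * m%:Z%:~R = (p ^ (n - l))%N%:Z%:~R :> rat.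
  by rewrite -!pmulrn divfK // natrX.
exists (Localized (locint_frac nz_m e).1) => /=.
rewrite em natrM natrX mulrA -exprS.
have -> : (n.+1 = (n - l).+1 + l)%N by lia.
rewrite exprD; field; rewrite nzm /=; exact: expf_neq0.
Qed.

(** The binomial formula modulo [X^(n+1)]: a perturbation of order [n >= 1]
    enters the coefficient of index [n] linearly. *)
Lemma seriesX_perturb (R : comNzRingType) (g h : series R) n m :
  (0 < n)%N -> g 0%N = 1 ->
  ((g + mon R n * h) ^+ m) n = (g ^+ m) n + m%:R * h 0%N.
Proof.
move=> n_gt0 g0.
(* Recording [k 0] only is enough, as [mon R n * k] starts with it. *)
have [k [-> k0]] : exists k, (g + mon R n * h) ^+ m = g ^+ m + mon R n * k
                             /\ k 0%N = m%:R * h 0%N.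
  elim: m => [|m [k [IHm k0]]].
    by exists 0; rewrite !expr0 mulr0 addr0 mul0r.
  exists (g * k + h * g ^+ m + mon R n * h * k); split.
    by rewrite !exprS IHm; ring.
  rewrite !sDE !sM0E sX0E g0 expr1n k0 /mon eq_sym eqn0Ngt n_gt0.
  by rewrite !mul0r addr0 -natr1; ring.
by rewrite sDE monME leqnn subnn k0.
Qed.

Section ArtinHasseIntegral.
Variable p : nat.
Hypothesis p_pr : prime p.
Let p_gt0 := prime_gt0 p_pr.
Local Notation u := (AH p : series rat).

Definition exp_pX : series rat := fun n => p%:R ^+ n / n`!%:R.

Lemma exp_pX0 : exp_pX 0%N = 1.
Proof. by rewrite /exp_pX expr0 divr1. Qed.

Lemma theta_exp_pX : theta exp_pX = p%:R * mon rat 1 * exp_pX.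
Proof.
apply/funext => n; rewrite -mulrA smul_natE monME /theta /exp_pX.
case: n => [|n]; first by rewrite mul0r mulr0.
have := fact_gt0 n; rewrite subn1 /= factS natrM exprS lt0n.
rewrite -(Num.Theory.pnatr_eq0 rat) => nz; field.
by rewrite nz nat1r Num.Theory.pnatr_eq0.
Qed.

(** Dwork's relation [AH (X)^p = AH (X^p) exp (p X)]: both sides satisfy the
    equation [theta f = p t f]. *)
Lemma AH_Dwork : u ^+ p = dilate p u * exp_pX.
Proof.
have d0 f : dilate p f 0 = f 0%N :> rat by rewrite /dilate dvdn0 div0n.
have p0 : ppowers rat p 0 = 0 by rewrite /ppowers logn0.
apply: (@ODE_unique (p%:R * ppowers rat p)).
- by rewrite smul_natE p0 mulr0.
- by rewrite sX0E sM0E d0 AH0 expr1n /exp_pX mul1r ?expr0 -[0`!]/1%N divr1.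
- rewrite -[X in theta (_ ^+ X)](prednK p_gt0) thetaX theta_AH // prednK //.
  by rewrite -[X in _ = _ * u ^+ X](prednK p_gt0) exprS; ring.
rewrite thetaM theta_dilate // theta_AH // dilateM // theta_exp_pX.
by rewrite [X in _ = _ * X * _]ppowersE //; ring.
Qed.

(** By induction on [n]: let [g] be the part of [AH] below order [n].  The
    coefficients of index [n] in Dwork's relation give [p u n] as the
    difference of the coefficients of [g (X^p)] and [g (X)^p], up to multiples of
    [p]; this difference is divisible by [p] by Frobenius. *)
Lemma AH_locint n : u n \in locint 'F_p.
Proof.
elim/ltn_ind: n => -[|n] IHn.
  by rewrite AH0 rpred1.
set N := n.+1 in IHn *.
pose g : series (localized 'F_p) := fun i => insubd 0 (if (i < N)%N then u i else 0).
have valg i : val (g i) = if (i < N)%N then u i else 0.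
  by apply: insubdK; case: ifP => [/IHn//|_]; exact: rpred0.
have eu : u = smap val g + mon rat N * (fun i => u (i + N)%N).
  apply/funext => i; rewrite sDE monME /smap valg; case: leqP => [leNi|ltiN].
    by rewrite subnK // add0r.
  by rewrite addr0.
have g0 : g 0%N = 1 by apply: val_inj; rewrite valg rmorph1 /= AH0.
(* Divisible by [p], since [g (X)^p] and [g (X^p)] agree modulo [p]. *)
pose w := (g ^+ p) N - (dilate p g) N.
have [x ew] : exists x, w = p%:R * x.
  apply: residue_eq0 => //.
  have er : residue ((g ^+ p) N) = dilate p (smap (@residue 'F_p) g) N.
    by rewrite -series_Frobenius // -rmorphXn.
  rewrite /w rmorphB /= er /dilate.
  by case: ifP; rewrite ?rmorph0 subrr.
(* The other terms of the product with [exp (p X)] carry a factor [p]. *)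
have [y ey] : exists y : localized 'F_p,
    (dilate p u * exp_pX) N = val (dilate p g N) + p%:R * val y.
  have ex (i : 'I_N) : exists y : localized 'F_p,
      dilate p u i * exp_pX (N - i)%N = p%:R * val y.
    have lt_iN := ltn_ord i.
    have -> : (N - i = (N - i).-1.+1)%N by lia.
    have [v ev] := pX_exp_int (N - i).-1 p_pr.
    rewrite /exp_pX ev; exists (dilate p g i * v).
    rewrite rmorphM /= /dilate; case: ifP => _; last by rewrite !mul0r mulr0.
    rewrite -[loc_val (g _)]/(val _) valg ifT; first by ring.
    exact: leq_ltn_trans (leq_div _ _) lt_iN.
  have [y ey] := boolp.choice ex.
  exists (\sum_i y i); rewrite sME big_ord_recr /= subnn addrC; congr (_ + _).
    rewrite exp_pX0 mulr1 /dilate; case: ifP => // _.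
    by rewrite -[RHS]/(val _) valg ifT // ltn_Pdiv // prime_gt1.
  rewrite -[loc_val _]/(val _) rmorph_sum mulr_sumr.
  by apply: eq_bigr => i _; rewrite ey.
have e : p%:R * u N = p%:R * val (y - x).
  have := congr1 (fun f : series rat => f N) AH_Dwork.
  rewrite {1}eu seriesX_perturb //; last by rewrite /smap g0 rmorph1.
  rewrite ey -rmorphXn /= {1}/smap add0n => e.
  have := congr1 val ew; rewrite !rmorphB rmorphM rmorph_nat /= => e'.
  rewrite mulrBr -e'; apply: (addrI (loc_val ((g ^+ p) N))); rewrite e; ring.
have -> : u N = val (y - x).
  by apply: mulfI e; rewrite Num.Theory.pnatr_eq0 -lt0n.
exact: valP.
Qed.

Definition AHloc : series (localized 'F_p) := fun n => Localized (AH_locint n).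

Lemma theta_AHloc : theta AHloc = ppowers _ p * AHloc.
Proof.
have valI (f g : series (localized 'F_p)) : smap val f = smap val g -> f = g.
  move=> e; apply/funext => n; apply: val_inj.
  exact: (congr1 (fun h : series rat => h n) e).
have sM (f g : series (localized 'F_p)) :
  smap val (f * g) = smap val f * smap val g := rmorphM _ _ _.
apply: valI; rewrite smap_theta sM smap_ppowers; exact: theta_AH.
Qed.

End ArtinHasseIntegral.

(** * Integer polynomials evaluated at series *)

Section IntEval.
Variable R : comNzRingType.

Definition ieval (x : R) (q : {poly int}) : R := (map_poly intr q).[x].

Lemma ieval_is_zmod_morphism x : zmod_morphism (ieval x).
Proof. by move=> q r; rewrite /ieval rmorphB hornerD hornerN. Qed.

Lemma ieval_is_monoid_morphism x : monoid_morphism (ieval x).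
Proof.
split=> [|q r]; rewrite /ieval; first by rewrite rmorph1 hornerC.
by rewrite rmorphM hornerM.
Qed.

HB.instance Definition _ x :=
  GRing.isZmodMorphism.Build {poly int} R (ieval x) (ieval_is_zmod_morphism x).
HB.instance Definition _ x :=
  GRing.isMonoidMorphism.Build {poly int} R (ieval x)
    (ieval_is_monoid_morphism x).

Lemma ievalX x : ieval x 'X = x.
Proof. by rewrite /ieval map_polyX hornerX. Qed.

Lemma ievalC x c : ieval x c%:P = c%:~R.
Proof. by rewrite /ieval map_polyC hornerC. Qed.

Lemma ievalE x (q : {poly int}) n : (size q <= n)%N ->
  ieval x q = \sum_(j < n) (q`_j)%:~R * x ^+ j.
Proof.
move=> le_qn; rewrite /ieval (horner_coef_wide _ (leq_trans (size_poly _ _) le_qn)).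
by apply: eq_bigr => j _; rewrite coef_map.
Qed.

End IntEval.

Lemma rmorph_ieval (R S : comNzRingType) (phi : {rmorphism R -> S}) x q :
  phi (ieval x q) = ieval (phi x) q.
Proof.
rewrite !(ievalE _ (leqnn _)) rmorph_sum; apply: eq_bigr => j _.
by rewrite rmorphM rmorphXn /= rmorph_int.
Qed.

Lemma theta_ieval (R : comNzRingType) (f : series R) q :
  theta (ieval f q) = ieval f q^`() * theta f.
Proof.
elim/poly_ind: q => [|q c IHq]; first by rewrite deriv0 !rmorph0 theta0 mul0r.
have theta_int : theta (c%:~R : series R) = 0.
  case: c => n; first by rewrite -pmulrn theta_nat.
  by rewrite NegzE rmorphN /= -pmulrn thetaN theta_nat oppr0.
rewrite derivD derivC addr0 derivM derivX mulr1 !rmorphD !rmorphM /= ievalX ievalC.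
by rewrite thetaD theta_int addr0 thetaM IHq; ring.
Qed.

(** * The product of the shifted factors *)

Definition rising m n : {poly int} := \prod_(m <= i < n) ('X + i%:R).

Lemma rising_recr m n : (m <= n)%N -> rising m n.+1 = rising m n * ('X + n%:R).
Proof. by move=> le_mn; rewrite /rising big_nat_recr. Qed.

Lemma rising_recl m n : (m < n)%N -> rising m n = ('X + m%:R) * rising m.+1 n.
Proof. by move=> lt_mn; rewrite /rising big_ltn. Qed.

Lemma rising_geq m n : (n <= m)%N -> rising m n = 1.
Proof. by move=> le_nm; rewrite /rising big_geq. Qed.

(** The Leibniz rule, with the product of the other factors cut at the
    differentiated one. *)
Lemma deriv_rising n : (0 < n)%N ->
  (rising 1 n)^`() = \sum_(1 <= s < n) rising 1 s * rising s.+1 n.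
Proof.
case: n => // n _; elim: n => [|n IHn].
  by rewrite big_geq // rising_geq // derivC.
rewrite rising_recr // derivM IHn derivD derivX -[n.+1%:R]polyC_natr derivC addr0.
rewrite mulr1 polyC_natr [RHS]big_nat_recr //= [rising n.+2 _]rising_geq // mulr1.
congr (_ + _); rewrite mulr_suml !big_nat; apply: eq_bigr => s /andP[_ lt_sn].
by rewrite [rising s.+1 n.+2]rising_recr ?mulrA.
Qed.

Lemma rising_monic_size m n :
  (m <= n)%N -> rising m n \is monic /\ size (rising m n) = (n - m).+1.
Proof.
move=> le_mn.
have [d ->] : exists d, n = (m + d)%N by exists (n - m)%N; rewrite subnKC.
rewrite addKn {n le_mn}; elim: d => [|d [IHm IHs]].
  by rewrite addn0 rising_geq // monic1 size_poly1.
rewrite addnS rising_recr ?leq_addr //.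
rewrite -[_%:R]opprK -polyC_natr -polyCN.
split; first by rewrite monicMl ?monicXsubC.
by rewrite size_monicM ?monicXsubC ?polyXsubC_eq0 // IHs size_XsubC addn2.
Qed.

Section RisingPrime.
Variable p : nat.
Hypothesis p_pr : prime p.
Let p_gt0 := prime_gt0 p_pr.
Let p_gt1 := prime_gt1 p_pr.

Lemma prod_Xadd_Fp :
  \prod_(i < p) ('X + i%:R) = 'X^p - 'X :> {poly 'F_p}.
Proof.
have := finField_genPoly 'F_p; rewrite card_Fp // => ->.
rewrite (reindex_inj (inv_inj (@opprK 'F_p))) /=.
have reindex q (F : nat -> {poly 'F_p}) : q = p ->
  \prod_(i < p) F i = \prod_(i < q) F i by move=> ->.
have eFp : (Zp_trunc (pdiv p)).+2 = p := Fp_cast p_pr.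
rewrite (reindex _ (fun i => 'X + i%:R) eFp); apply: eq_bigr => i _.
rewrite polyCN opprK; congr (_ + _); rewrite -polyC_natr; congr (_%:P).
by apply: val_inj; rewrite /= val_Fp_nat ?modn_small // -[X in (_ < X)%N]eFp.
Qed.

Lemma int_poly_residue_eq0 (q : {poly int}) :
  map_poly (intr : int -> 'F_p) q = 0 -> exists r, q = p%:R * r.
Proof.
move=> q0; exists (\poly_(i < size q) (q`_i %/ p)%Z).
apply/polyP => i; rewrite -polyC_natr coefCM coef_poly.
case: ltnP => [_|le_qi]; last by rewrite mulr0 nth_default.
have := congr1 (fun r : {poly _} => r`_i) q0; rewrite coef_map coef0.
by move/eqP; rewrite intFp_eq0 // => p_dvd; rewrite mulrC natz divzK.
Qed.

(** Fermat's little theorem for polynomials, lifted to the integers.  The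
    constant coefficient of [K] is the Wilson quotient, the others turn out to
    be Bernoulli numbers modulo [p], up to scaling. *)
Lemma rising_wilson : exists K : {poly int},
  rising 1 p = 'X^(p.-1) - 1 + p%:R * K /\ (size K <= p.-1)%N.
Proof.
have [|K eK] := @int_poly_residue_eq0 (rising 1 p - ('X^(p.-1) - 1)).
  apply: (mulfI (negbT (polyX_eq0 'F_p))).
  rewrite mulr0 rmorphB mulrBr rmorphB rmorphXn rmorph1 /= map_polyX.
  rewrite mulrBr -exprS prednK // mulr1.
  rewrite -prod_Xadd_Fp -(big_mkord xpredT (fun i => 'X + i%:R)) big_ltn //.
  rewrite addr0 /rising rmorph_prod /=.
  rewrite [X in _ * X - _](eq_bigr (fun i => 'X + i%:R)) ?subrr // => i _.
  by rewrite rmorphD rmorph_nat /= map_polyX.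
exists K; split; first by rewrite -eK; ring.
have [monG szG] := rising_monic_size p_gt0.
suff : (size (p%:R * K)%R <= p.-1)%N.
  rewrite -polyC_natr mul_polyC size_scale //.
  by rewrite Num.Theory.pnatr_eq0 -lt0n.
rewrite -eK; apply/leq_sizeP => j; rewrite leq_eqVlt => /predU1P[<-|lt_pj].
  have := monicP monG; rewrite lead_coefE szG subn1 /= => lG.
  rewrite !coefB lG coefXn eqxx coef1 (_ : (p.-1 == 0)%N = false) ?subr0 ?subrr //.
  by apply/eqP; lia.
rewrite !coefB coefXn coef1 nth_default ?szG; last by rewrite subn1.
have -> : (j == p.-1)%N = false by apply/eqP; lia.
by rewrite (_ : (j == 0)%N = false) ?subrr //; apply/eqP; lia.
Qed.

End RisingPrime.

(** * The coefficients of index divisible by [p], modulo [p] *)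

Lemma block_sneg (R : comNzRingType) p s (f : series R) : odd p ->
  block p s (sneg f) = (-1) ^+ s * sneg (block p s f).
Proof.
move=> odd_p; apply/funext => r; rewrite /block /sneg.
have -> : (-1) ^+ (r * p + s) = (-1) ^+ s * (-1) ^+ r :> R.
  rewrite -signr_odd oddD oddM odd_p andbT.
  by rewrite -oddD signr_odd exprD mulrC.
rewrite -!(signr_odd _ s); case: (odd s); rewrite ?expr0 ?mul1r //.
by rewrite !expr1 !mulN1r sNE mulNr.
Qed.

Lemma nat_series_Fp p : prime p -> p%:R = 0 :> series 'F_p.
Proof.
move=> p_pr; apply/funext => n; rewrite -[p%:R]mulr1 smul_natE.
by rewrite pchar_Fp_0 ?mul0r.
Qed.

Section NormModP.
Variables (p : nat) (a : series 'F_p).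
Hypotheses (p_pr : prime p) (odd_p : odd p).
Hypotheses (theta_a : theta a = ppowers 'F_p p * a) (norm_a : a * sneg a = 1).
Local Notation t := (ppowers 'F_p p).
Local Notation U s := (block p s a).
Let p_gt0 := prime_gt0 p_pr.
Let p_gt1 := prime_gt1 p_pr.

(** Modulo [p], the variable is [t - t^p], so that [t] is the Artin-Schreier
    root of the variable. *)
Lemma mon1_ppowers : mon 'F_p 1 = t - t ^+ p.
Proof. by rewrite series_Frobenius // [X in X - _]ppowersE // addrK. Qed.

Lemma block_modpS s : (s.+1 < p)%N -> U s = (s.+1%:R - t) * U s.+1.
Proof.
move=> lt_sp; have := ODE_blockS p_pr theta_a lt_sp.
by rewrite nat_series_Fp // mul0r addr0 mulrBl => ->; rewrite addrK.
Qed.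

Lemma block_modpE s : (s < p)%N ->
  U s = ieval (- t) (rising s.+1 p) * U p.-1.
Proof.
move=> lt_sp; have [d ed] : exists d, (s + d = p.-1)%N.
  by exists (p.-1 - s)%N; lia.
elim: d s ed {lt_sp} => [|d IHd] s ed.
  by rewrite addn0 in ed; rewrite ed prednK // rising_geq // rmorph1 mul1r.
rewrite block_modpS ?(IHd s.+1) ?(@rising_recl s.+1); try lia.
by rewrite rmorphM rmorphD /= ievalX rmorph_nat; ring.
Qed.

(** Reflection [i -> p - i] in the product. *)
Lemma rising_modp_opp s : (0 < s <= p)%N ->
  ieval t (rising (p - s).+1 p) = (-1) ^+ s.-1 * ieval (- t) (rising 1 s).
Proof.
case: s => // s /=; elim: s => [|s IHs] le_sp.
  by rewrite subn1 prednK // !rising_geq // !rmorph1 mulr1.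
rewrite rising_recl; last lia.
rewrite (_ : (p - s.+2).+2 = (p - s.+1).+1); last lia.
rewrite rmorphM /= IHs 1?ltnW // (@rising_recr 1 s.+1) // rmorphM !rmorphD /= !ievalX.
rewrite (_ : (p - s.+2).+1 = (p - s.+1)%N) ?rmorph_nat; last lia.
by rewrite natrB ?nat_series_Fp ?(ltnW le_sp) // exprS; ring.
Qed.

(** In the coefficients of [AH (X) AH (- X) = 1] of index divisible by [p], the
    block [s] meets the block [p - s], and contributes the product of all the
    [i - t], [0 < i < p], except [s - t].  The sum of these products over [s] is
    a derivative of [t^(p-1) - 1], up to sign. *)
Lemma norm_block0 : U 0 * sneg (U 0) = 1 - t ^+ p.-1.
Proof.
(* All blocks are multiples of [V], which spares inverting the [i - t]. *)
pose V := U p.-1; pose N := V * sneg V; pose q := t ^+ p.-1.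
have [K [eG _]] := rising_wilson p_pr.
have eGt : ieval (- t) (rising 1 p) = q - 1.
  rewrite eG rmorphD rmorphM rmorphB rmorphXn rmorph1 rmorph_nat /= ievalX.
  rewrite nat_series_Fp // mul0r addr0 exprNn -signr_odd.
  by rewrite -[in odd _]subn1 oddB // odd_p expr0 mul1r.
have eU0 : U 0 = (q - 1) * V by rewrite block_modpE // eGt.
have sq : sneg q = q.
  rewrite /q rmorphXn /= sneg_ppowers // exprNn -signr_odd.
  by rewrite -[in odd _]subn1 oddB // odd_p expr0 mul1r.
have eU0' : sneg (U 0) = (q - 1) * sneg V.
  by rewrite eU0 snegM snegD snegN sneg1 sq.
have term s : (1 <= s < p)%N ->
    U s * block p (p - s) (sneg a)
      = ieval (- t) (rising 1 s * rising s.+1 p) * N.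
  move=> /andP[s_gt0 lt_sp]; rewrite block_sneg // block_modpE //.
  rewrite (@block_modpE (p - s)); last lia.
  rewrite !rmorphM /= rmorph_ieval /= rmorphN /= sneg_ppowers // opprK.
  rewrite rising_modp_opp ?s_gt0 1?ltnW // /N -/V.
  have -> : (-1) ^+ (p - s) = (-1) ^+ s.-1 :> series 'F_p.
    rewrite -signr_odd -[RHS]signr_odd; congr (_ ^+ nat_of_bool _).
    by case: s s_gt0 lt_sp => // s _ lt_sp; rewrite oddB 1?ltnW // odd_p /= negbK.
  have := sqrr_sign (series 'F_p) s.-1; move: (_ ^+ s.-1) => e ee.
  rewrite [RHS]mulrC -[RHS]mul1r -ee; ring.
have : block p 0 (a * sneg a) = 1.
  rewrite norm_a; apply/funext => r; rewrite /block !s1E addn0 muln_eq0.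
  by rewrite (gtn_eqF p_gt0) orbF.
rewrite block0M // block_sneg // expr0 mul1r.
rewrite (eq_big_nat _ _ term) -mulr_suml -rmorph_sum -deriv_rising //= eG.
have -> : ieval (- t) ('X^(p.-1) - 1 + p%:R * K)^`() = t ^+ p.-2.
  rewrite derivD derivB derivC derivXn subr0 -polyC_natr mul_polyC derivZ.
  rewrite -mul_polyC polyC_natr rmorphD rmorphM rmorphMn rmorphXn rmorph_nat /=.
  rewrite nat_series_Fp // mul0r addr0 ievalX -mulr_natl.
  have -> : p.-1%:R = -1 :> series 'F_p.
    by rewrite -subn1 natrB // nat_series_Fp // sub0r.
  rewrite exprNn -signr_odd; have -> : odd p.-2 = true.
    by rewrite -subn2 oddB // odd_p.
  by rewrite expr1; ring.
rewrite eU0' eU0 mon1_ppowers.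
have -> : t ^+ p = t * q by rewrite -exprS prednK.
have -> : (t - t * q) * (t ^+ p.-2 * N) = q * (1 - q) * N.
  have eq2 : q = t * t ^+ p.-2 by rewrite -exprS prednK // -subn1 subn_gt0.
  by rewrite [X in _ = X * _ * _]eq2; ring.
move=> eN; have {}eN : (1 - q) * N = 1 by rewrite -[RHS]eN /N; ring.
transitivity ((1 - q) * ((1 - q) * N)); first by rewrite /N; ring.
by rewrite eN mulr1.
Qed.

End NormModP.

(** * The differential equation for the coefficients of index divisible by [p] *)

Section ModPSquare.
Variables (R : comNzRingType) (p : nat) (f : series R).
Hypotheses (p_pr : prime p) (odd_p : odd p).
Hypothesis theta_f : theta f = ppowers R p * f.
Local Notation t := (ppowers R p).
Local Notation U s := (block p s f).
Let p_gt0 := prime_gt0 p_pr.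

Lemma theta_sign i (g : series R) : theta ((-1) ^+ i * g) = (-1) ^+ i * theta g.
Proof.
by rewrite -signr_odd; case: odd; rewrite ?expr0 ?expr1 ?mul1r // !mulN1r thetaN.
Qed.

(** The operators whose product eliminates all the blocks but the first: the
    [i]-th one maps [shifted_block i] to the next.  The factor [Y] in front of
    the block [p - i] shifts [theta] by one, hence [p theta] by [p], which
    turns the constant [i - p] of the equation of that block into [i]. *)
Definition shifted_op s (V : series R) : series R :=
  (t + s%:R) * V - p%:R * theta V.

Definition shifted_block i : series R :=
  if i is 0%N then U 0 else (-1) ^+ i * (mon R 1 * U (p - i)).

Lemma shifted_blockS i : (i < p)%N ->
  shifted_op i (shifted_block i) = shifted_block i.+1.
Proof.
rewrite /shifted_op; case: i => [|i] lt_ip /=.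
  rewrite addr0 ODE_block0 // subn1 expr1; ring.
have lt_s : ((p - i.+2).+1 < p)%N by lia.
have := ODE_blockS p_pr theta_f lt_s.
rewrite (_ : (p - i.+2).+1 = (p - i.+1)%N); last lia.
move=> e.
have {}e : U (p - i.+2) = (p - i.+1)%:R * U (p - i.+1)
                     + p%:R * theta (U (p - i.+1)) - t * U (p - i.+1).
  by rewrite e addrK.
rewrite theta_sign thetaM theta_mon [_ ^+ i.+2]exprS e natrB ?(ltnW lt_ip) //.
by move: ((-1) ^+ i.+1) => sgn; ring.
Qed.

(** Composing the operators [t + s - p theta] and moving the derivations to the
    right: modulo [p^2] at most one derivation survives, and it hits either
    [U 0], or one of the factors, which gives a second derivative.  The factor
    [2] avoids halving the latter. *)
Lemma shifted_block_expansion i : (i <= p)%N ->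
  exists r, 2%:R * shifted_block i
    = 2%:R * ieval t (rising 0 i) * U 0
      - 2%:R * p%:R * ieval t (rising 0 i)^`() * theta (U 0)
      - p%:R * ieval t (rising 0 i)^`()^`() * theta t * U 0
      + p%:R ^+ 2 * r.
Proof.
elim: i => [|i IHi] lt_ip.
  exists 0; rewrite rising_geq // derivC linear0 !rmorph0 rmorph1 /=; ring.
have [r er] := IHi (ltnW lt_ip).
rewrite -shifted_blockS // /shifted_op.
have -> : 2%:R * ((t + i%:R) * shifted_block i - p%:R * theta (shifted_block i))
  = (t + i%:R) * (2%:R * shifted_block i) - p%:R * theta (2%:R * shifted_block i).
  by rewrite theta_natM; ring.
rewrite er rising_recr //.
set F := rising 0 i; set F1 := F^`(); set F2 := F1^`().
have eD1 : (F * ('X + i%:R))^`() = F1 * ('X + i%:R) + F.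
  by rewrite derivM derivD derivX -polyC_natr derivC addr0 mulr1.
have eD2 : (F * ('X + i%:R))^`()^`() = F2 * ('X + i%:R) + 2%:R * F1.
  rewrite eD1 derivD derivM derivD derivX -polyC_natr derivC addr0 mulr1.
  by rewrite -/F1; ring.
rewrite eD2 eD1.
have [B eB] : exists B,
    B = 2%:R * (ieval t F1 * theta (U 0)) + ieval t F2 * (theta t * U 0).
  by eexists.
exists ((t + i%:R) * r + theta B - p%:R * theta r).
have -> : 2%:R * ieval t F * U 0 - 2%:R * p%:R * ieval t F1 * theta (U 0)
    - p%:R * ieval t F2 * theta t * U 0 + p%:R ^+ 2 * r
  = 2%:R * (ieval t F * U 0) - p%:R * B + (p ^ 2)%:R * r.
  by rewrite natrX eB; ring.
rewrite !thetaD thetaN !theta_natM [theta (ieval t F * _)]thetaM theta_ieval -/F1.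
move: (theta B) => TB; rewrite eB natrX.
by rewrite !(rmorphD, rmorphM, rmorph_nat, rmorph1) /= ievalX; ring.
Qed.

(** The previous expansion at [i = p] compares to [shifted_block p = - Y (U 0)].
    With [M = X K], the first derivative of [X^p - X + p M] is [-1] modulo [p], and the second
    one vanishes modulo [p]; hence all terms are divisible by [p], and only
    [theta (U 0)] and the quotient by [p] of the leading term remain. *)
Lemma block0_ODE (K : {poly int}) (S : series R) :
    (forall (g h : series R), p%:R * g = p%:R * h -> g = h) ->
    rising 1 p = 'X^(p.-1) - 1 + p%:R * K ->
    t ^+ p - t + mon R 1 = p%:R * S ->
  exists r, 2%:R * ((S + t * ieval t K) * U 0 + theta (U 0)) = p%:R * r.
Proof.
move=> p_inj eG eS; have [r] := shifted_block_expansion (leqnn p).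
have -> : shifted_block p = - (mon R 1 * U 0).
  rewrite /shifted_block; case: (p) p_gt0 odd_p => // n _ odd_n.
  by rewrite subnn -signr_odd odd_n expr1 mulN1r.
have -> : rising 0 p = 'X^p - 'X + p%:R * ('X * K).
  rewrite rising_recl // addr0 eG.
  by rewrite -[X in _ = 'X^X - _ + _](prednK p_gt0) exprS; ring.
set M := 'X * K.
have eD : ('X^p - 'X + p%:R * M)^`() = p%:R * ('X^(p.-1) + M^`()) - 1.
  rewrite derivD derivB derivX derivXn -polyC_natr mul_polyC derivZ -mul_polyC.
  by rewrite polyC_natr -mulr_natl; ring.
have eD2 : ('X^p - 'X + p%:R * M)^`()^`() = p%:R * ('X^(p.-1) + M^`())^`().
  by rewrite eD derivB derivC subr0 -polyC_natr mul_polyC derivZ mul_polyC.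
have -> : ieval t ('X^p - 'X + p%:R * M) = t ^+ p - t + p%:R * (t * ieval t K).
  by rewrite /M !(rmorphD, rmorphN, rmorphM, rmorph_nat, rmorphXn) /= ievalX.
rewrite eD2 eD; set M1 := 'X^_ + _.
rewrite rmorphB !rmorphM rmorph1 rmorph_nat /=.
move: (ieval t M1) (ieval t M1^`()) => m1 m2 er.
exists (2%:R * m1 * theta (U 0) + m2 * theta t * U 0 - r).
apply: p_inj.
have eS2 : t ^+ p - t = p%:R * S - mon R 1 by rewrite -eS; ring.
rewrite eS2 in er.
apply/eqP; rewrite -subr_eq0; move/eqP: er; rewrite -subr_eq0 => /eqP er.
by apply/eqP; rewrite -[RHS]oppr0 -er; ring.
Qed.

End ModPSquare.

(** * Bernoulli numbers modulo [p] *)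

Section ReducesTo.
Variable F : fieldType.

Definition reduces_to (x : rat) (y : F) := x \in locint F /\ ratr x = y.

Lemma reduces_to_nat n : reduces_to n%:R n%:R.
Proof. exact: locint_nat. Qed.

Lemma reduces_toB x x' y y' :
  reduces_to x y -> reduces_to x' y' -> reduces_to (x - x') (y - y').
Proof. by move=> [lx <-] [lx' <-]; exact: locint_opB. Qed.

Lemma reduces_toM x x' y y' :
  reduces_to x y -> reduces_to x' y' -> reduces_to (x * x') (y * y').
Proof. by move=> [lx <-] [lx' <-]; exact: locint_opM. Qed.

Lemma reduces_to_sum (I : Type) (r : seq I) (P : pred I) (f : I -> rat) g :
    (forall i, P i -> reduces_to (f i) (g i)) ->
  reduces_to (\sum_(i <- r | P i) f i) (\sum_(i <- r | P i) g i).
Proof.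
move=> fg; elim/big_rec2: _ => [|i x y Pi red_xy]; first exact: (reduces_to_nat 0).
rewrite -[x]opprK -[y]opprK; apply: reduces_toB; first exact: fg.
by rewrite -[- x]add0r -[- y]add0r; apply: reduces_toB => //; exact: (reduces_to_nat 0).
Qed.

Lemma reduces_to_div n x y : n%:R != 0 :> F ->
  reduces_to (x * n%:R) (y * n%:R) -> reduces_to x y.
Proof.
move=> nz_n [lx ex]; set z := x * n%:R in lx ex.
have nz : (n%:Z * denq z)%:~R != 0 :> F by rewrite rmorphM mulf_neq0.
have e : x * (n%:Z * denq z)%:~R = (numq z)%:~R.
  by rewrite rmorphM /= mulrA -[X in X * _]/z -numqE.
split; first by case: (locint_frac nz e).
rewrite (ratr_frac nz e) rmorphM /= invfM mulrCA -[_ / _]/(ratr z) ex mulrC.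
exact: mulfK.
Qed.

End ReducesTo.

Section Bernoulli.
Variable p : nat.
Hypotheses (p_pr : prime p) (odd_p : odd p).
Variable K : {poly int}.
Hypothesis rising_p : rising 1 p = 'X^(p.-1) - 1 + p%:R * K.
Hypothesis size_K : (size K <= p.-1)%N.
Let p_gt0 := prime_gt0 p_pr.
Let p_gt1 := prime_gt1 p_pr.
Local Notation kappa m := ((K`_(p.-1 - m))%:~R : 'F_p).

Lemma natFp_p : p%:R = 0 :> 'F_p.
Proof. by apply/eqP; rewrite natFp_eq0. Qed.

(** Modulo [p] the upper index is the negative number [- 1 - a]. *)
Lemma bin_Fp a b : (a + b < p)%N ->
  'C(p.-1 - a, b)%:R = (-1) ^+ b * 'C(a + b, b)%:R :> 'F_p.
Proof.
elim: b => [|b IHb] lt_p; first by rewrite !bin0 mul1r.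
have nz : b.+1%:R != 0 :> 'F_p by rewrite natFp_eq0 // gtnNdvd //; lia.
apply: (mulfI nz); rewrite -natrM mul_bin_left natrM IHb; last lia.
rewrite [RHS]mulrCA -natrM addnS -mul_bin_diag natrM exprS /=.
rewrite (_ : (p.-1 - a - b = p - (a + b).+1)%N); last lia.
by rewrite natrB ?natFp_p; [ring|lia].
Qed.

Lemma rising_shift :
  (rising 1 p \Po ('X + 1)) * ('X + 1) = rising 1 p * ('X + p%:R).
Proof.
rewrite -rising_recr // (@rising_recl 1 p.+1) // mulrC; congr (_ * _).
rewrite /rising rmorph_prod [RHS]big_add1 /=; apply: eq_bigr => i _.
rewrite rmorphD rmorph_nat /= comp_polyX.
by rewrite -addrA nat1r.
Qed.

(** The coefficient of [X^i] in [rising_shift], written in terms of [K]: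
    everything is divisible by [p], and [i] clears the denominator of
    ['C(p, i) / p]. *)
Lemma wilson_poly_rec i : (0 < i < p.-1)%N ->
  'C(p.-1, i.-1)%:R
    + i%:R * (\sum_(i.+1 <= j < p) 'C(j, i)%:R * K`_j.-1) = (p * i)%N%:R * K`_i.
Proof.
move=> /andP[i_gt0 lt_ip].
pose E := 'X * K.
have shift : ('X + 1) ^+ p - 'X^p - 1 + p%:R * (E \Po ('X + 1) - E)
           = p%:R * rising 1 p.
  have := rising_shift; rewrite rising_p.
  rewrite !(rmorphD, rmorphN, rmorphM, rmorphXn, rmorph1, rmorph_nat) /=.
  rewrite !comp_polyX => e.
  have eXp : 'X^p = 'X * 'X^(p.-1) :> {poly int} by rewrite -exprS prednK.
  have eX1p : ('X + 1) ^+ p = ('X + 1) * ('X + 1) ^+ p.-1 :> {poly int}.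
    by rewrite -exprS prednK.
  rewrite eXp eX1p /E; move: (('X + 1) ^+ p.-1) ('X^(p.-1)) (K \Po _) e => A B C e.
  apply/eqP; rewrite -subr_eq0; move/eqP: e.
  by rewrite -subr_eq0 => /eqP e; apply/eqP; rewrite -[RHS]e; ring.
have coefX1 n : (('X + 1) ^+ n)`_i = 'C(n, i)%:R :> int.
  rewrite addrC exprDn coef_sum.
  have [le_in | lt_ni] := leqP i n; last first.
    rewrite bin_small // big1 // => j _.
    rewrite expr1n mul1r coefMn coefXn (_ : (i == j)%N = false) ?mul0rn //.
    by apply/eqP; have := ltn_ord j; lia.
  rewrite (bigD1 (Ordinal (le_in : (i < n.+1)%N))) //= big1 ?addr0 => [|j].
    by rewrite expr1n mul1r coefMn coefXn eqxx.
  rewrite -val_eqE /= => /negPf ne_ji.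
  by rewrite expr1n mul1r coefMn coefXn eq_sym ne_ji mul0rn.
have coefE j : E`_j = if j is j'.+1 then K`_j' else 0.
  by rewrite /E coefXM; case: j.
have sizeE : (size E <= p)%N.
  apply/leq_sizeP => -[|j] le_pj; rewrite coefE // nth_default //.
  by apply: leq_trans size_K _; rewrite -ltnS prednK.
have := congr1 (fun q : {poly int} => q`_i) shift.
rewrite !(coefD, coefN) coefX1 coefXn coef1 -polyC_natr !coefCM.
rewrite (_ : (i == p)%N = false); last by apply/eqP; lia.
rewrite (_ : (i == 0)%N = false); last by apply/eqP; lia.
have -> : (E \Po ('X + 1) - E)`_i = \sum_(i.+1 <= j < p) 'C(j, i)%:R * K`_j.-1.
  rewrite coefB.
  have -> : (E \Po ('X + 1))`_i = \sum_(0 <= j < p) 'C(j, i)%:R * E`_j.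
    rewrite comp_polyE coef_sum.
    rewrite (big_ord_widen _ (fun j => (E`_j *: ('X + 1) ^+ j)`_i) sizeE).
    rewrite big_mkcond big_mkord; apply: eq_bigr => j _.
    rewrite coefZ coefX1 mulrC; case: ltnP => // le_Ej.
    by rewrite nth_default ?mulr0.
  rewrite (big_cat_nat (n := i.+1)) //=; last lia.
  rewrite big_nat_recr //= binn mul1r big_nat big1 ?add0r => [|j /andP[_ lt_ji]].
    rewrite addrAC subrr add0r !big_nat; apply: eq_bigr => -[|j] // _.
    by rewrite coefE.
  by rewrite bin_small ?mul0r.
have -> : (rising 1 p)`_i = p%:R * K`_i.
  rewrite rising_p !(coefD, coefN) coefXn coef1 -polyC_natr coefCM.
  rewrite (_ : (i == p.-1)%N = false); last by apply/eqP; lia.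
  by rewrite (_ : (i == 0)%N = false) ?subr0 ?add0r //; apply/eqP; lia.
rewrite subr0 subr0 => e.
have p_neq0 : p%:R != 0 :> int by rewrite Num.Theory.pnatr_eq0 -lt0n.
apply: (mulfI p_neq0); rewrite mulrDr mulrCA.
have -> : p%:R * 'C(p.-1, i.-1)%:R = i%:R * 'C(p, i)%:R :> int.
  by rewrite -!natrM mul_bin_diag prednK.
by rewrite -mulrDr e natrM; ring.
Qed.

(** The coefficients of [K] in reverse order; the scaling is chosen to make
    them equal to the Bernoulli numbers modulo [p]. *)
Definition scaled_coef m : 'F_p :=
  if m is 0%N then 1 else (-1) ^+ m.-1 * m%:R * kappa m.

(** This is [wilson_poly_rec] modulo [p] at [i = p - 1 - n], where [bin_Fp]
    reflects the binomial coefficients. *)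
Lemma scaled_coef_rec n : (n <= p - 2)%N ->
  \sum_(m < n.+1) 'C(n.+1, m)%:R * scaled_coef m = (n == 0%N)%:R.
Proof.
case: n => [|n] le_np; first by rewrite big_ord1 bin0 mulr1.
(* The index [i] is congruent to [- (N + 1)] modulo [p]. *)
set N := n.+1 in le_np *; set i := (p.-1 - N)%N.
have i_int : (0 < i < p.-1)%N by rewrite /i; lia.
have sgn_i : (-1) ^+ i.-1 = - (-1) ^+ N :> 'F_p.
  rewrite -[RHS]mulN1r -exprS -signr_odd -[RHS]signr_odd; congr (_ ^+ nat_of_bool _).
  have e : (i.-1 + N.+1 = p.-1)%N by rewrite /i; lia.
  have := congr1 odd e; rewrite oddD -[in RHS]subn1 oddB // odd_p.
  by case: (odd i.-1) (odd N.+1) => [] [].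
have natr_i : i%:R = - N.+1%:R :> 'F_p.
  rewrite (_ : i = p - N.+1)%N; last by rewrite /i; lia.
  by rewrite natrB ?natFp_p ?sub0r //; lia.
have /(congr1 (intr : int -> 'F_p)) := wilson_poly_rec i_int.
rewrite rmorphD !rmorphM rmorph_sum !rmorph_nat natFp_p !mul0r /=.
rewrite -{1}[p.-1]subn0 bin_Fp ?add0n ?binn ?mulr1; last by rewrite /i; lia.
rewrite sgn_i natr_i.
have -> : \sum_(i.+1 <= j < p) ('C(j, i)%:R * K`_j.-1)%:~R
        = (-1) ^+ N * \sum_(m < N) (-1) ^+ m * 'C(N, m)%:R * kappa m.+1 :> 'F_p.
  rewrite -[i.+1]add0n big_addn (_ : (p - i.+1 = N)%N); last by rewrite /i; lia.
  rewrite big_nat_rev big_mkord mulr_sumr; apply: eq_bigr => m _.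
  have lt_mN := ltn_ord m.
  rewrite (_ : (0 + N - m.+1 + i.+1 = p.-1 - m)%N); last by rewrite /i; lia.
  rewrite -bin_sub; last by rewrite /i; lia.
  rewrite (_ : (p.-1 - m - i = N - m)%N); last by rewrite /i; lia.
  rewrite rmorphM rmorph_nat /= bin_Fp; last by lia.
  rewrite subnKC 1?ltnW // bin_sub 1?ltnW //.
  rewrite (_ : (p.-1 - m).-1 = p.-1 - m.+1)%N; last lia.
  rewrite (_ : (-1) ^+ N = (-1) ^+ (N - m) * (-1) ^+ m); last first.
    by rewrite -exprD subnK // ltnW.
  have := sqrr_sign 'F_p m; move: ((-1) ^+ m) ((-1) ^+ (N - m)) => e1 e2 ee.
  by rewrite -[LHS]mul1r -ee; ring.
move=> e; rewrite big_ord_recl bin0 mulr1 /=.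
have -> : \sum_(m < N) 'C(N.+1, bump 0 m)%:R *
                        ((-1) ^+ m * (bump 0 m)%:R * kappa (bump 0 m))
        = N.+1%:R * \sum_(m < N) (-1) ^+ m * 'C(N, m)%:R * kappa m.+1 :> 'F_p.
  rewrite mulr_sumr; apply: eq_bigr => m _; rewrite /bump /= add1n.
  have := mul_bin_diag N.+1 m; rewrite /= => /(congr1 (fun k => k%:R : 'F_p)).
  by rewrite !natrM => ebin; rewrite !mulrA [_ * 'C(N, m)%:R]mulrAC ebin; ring.
move: e; set s := \sum_(m < N) _; have := sqrr_sign 'F_p N.
move: ((-1) ^+ N) => e1 ee e.
transitivity (- e1 * (- e1 + - N.+1%:R * (e1 * s))); last by rewrite e mulr0.
by rewrite -[LHS]mul1r -[X in X * _ = _]ee; ring.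
Qed.

(** Both sides satisfy the same recursion, which determines the term of index
    [m] as long as [m + 1] is invertible modulo [p]. *)
Lemma bernoulli_reduces m : (m <= p - 2)%N ->
  reduces_to (bernoulli m) (scaled_coef m).
Proof.
elim/ltn_ind: m => m IHm le_mp.
have nz : m.+1%:R != 0 :> 'F_p by rewrite natFp_eq0 // gtnNdvd //; lia.
apply: (reduces_to_div nz).
have := bernoulli_rec m; have := scaled_coef_rec le_mp.
rewrite !big_ord_recr /= binSn [_%:R * bernoulli m]mulrC [_%:R * scaled_coef m]mulrC.
move=> /(canRL (addKr _)) -> /(canRL (addKr _)) ->; rewrite ![- _ + _]addrC.
apply: reduces_toB; first exact: reduces_to_nat.
apply: reduces_to_sum => i _; apply: reduces_toM; first exact: reduces_to_nat.
by apply: IHm => //; have := ltn_ord i; lia.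
Qed.

End Bernoulli.

Lemma smul_intE (R : comNzRingType) (c : int) (f : series R) n :
  (c%:~R * f) n = c%:~R * f n.
Proof.
case: c => c; first by rewrite -!pmulrn smul_natE.
by rewrite NegzE !rmorphN /= -!pmulrn mulNr sNE smul_natE mulNr.
Qed.

Lemma smul_signE (R : comNzRingType) i (f : series R) n :
  ((-1) ^+ i * f) n = (-1) ^+ i * f n.
Proof.
by rewrite -!(signr_odd _ i); case: odd; rewrite ?expr0 ?mul1r // !mulN1r.
Qed.

(** * Coefficients of low order *)

Section LowOrder.
Variables (R : comNzRingType) (p : nat).
Hypotheses (p_pr : prime p) (odd_p : odd p).
Local Notation t := (ppowers R p).
Let p_gt0 := prime_gt0 p_pr.
Let p_gt2 : (2 < p)%N := odd_prime_gt2 odd_p p_pr.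

Lemma ppowers_low : eq_below (3 * p) t (mon R 1 + mon R p).
Proof.
have low m : (m < 3)%N -> t m = (m == 1%N)%:R.
  move=> lt_m3; rewrite {1}ppowersE // sDE /mon /dilate.
  case: ifP => [p_dvd_m|_]; last by rewrite addr0.
  have -> : m = 0%N.
    by apply/eqP; move: p_dvd_m; apply: contraLR; rewrite -lt0n => m_gt0;
      rewrite gtnNdvd //; lia.
  by rewrite div0n /ppowers logn0 addr0.
move=> n lt_n; rewrite {1}ppowersE // !sDE; congr (_ + _).
rewrite /dilate /mon; case: ifP => [/dvdnP[m em]|p_ndvd_n].
  rewrite em mulnK // low; last by rewrite -(ltn_pmul2r p_gt0) -em.
  by rewrite -{2}[p]mul1n eqn_pmul2r.
by case: eqP => // en; rewrite en dvdnn in p_ndvd_n.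
Qed.

(** This is the expansion of [(Y + Y^p)^a]; its terms with at least three
    factors [Y^p] have order at least [3 p]. *)
Lemma ppowersX_low a n : (n < 3 * p)%N ->
  (t ^+ a) n = (n == a)%:R + a%:R * (n == a + p.-1)%N%:R
               + 'C(a, 2)%:R * (n == a + 2 * p.-1)%N%:R.
Proof.
elim: a n => [|a IHa] n lt_n.
  by rewrite expr0 s1E bin0n !mul0r !addr0.
rewrite exprS (eq_belowM ppowers_low (fun _ _ => erefl) lt_n).
rewrite mulrDl sDE !monME.
rewrite -!natrM -!natrD.
have -> : (if (1 <= n)%N then (t ^+ a) (n - 1)%N else 0)
  = ((0 < n) * ((n == a.+1) + a * (n == a.+1 + p.-1)
                + 'C(a, 2) * (n == a.+1 + 2 * p.-1)))%N%:R.
  case: n lt_n => [|n] lt_n; first by rewrite mul0n.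
  by rewrite IHa ?subn1 ?mul1n ?natrD ?natrM //=; lia.
have -> : (if (p <= n)%N then (t ^+ a) (n - p)%N else 0)
  = ((n == a.+1 + p.-1) + a * (n == a.+1 + 2 * p.-1))%N%:R.
  case: leqP => [le_pn|lt_np].
    rewrite IHa; last lia.
    rewrite (_ : (n - p == a)%N = (n == a.+1 + p.-1)%N); last by lia.
    rewrite (_ : (n - p == a + p.-1)%N = (n == a.+1 + 2 * p.-1)%N); last by lia.
    rewrite natrD natrM; case: (ltnP a 2) => [lt_a2|le_2a].
      by rewrite bin_small // mul0r addr0.
    by rewrite (_ : (n - p == a + 2 * p.-1)%N = false) ?mulr0 ?addr0 //; lia.
  rewrite (_ : (n == a.+1 + p.-1)%N = false); last by lia.
  by rewrite (_ : (n == a.+1 + 2 * p.-1)%N = false) ?muln0 //; lia.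
rewrite -natrD; congr (_%:R); rewrite binS bin1.
case: n {lt_n} => [|n]; first by lia.
by rewrite mul1n; ring.
Qed.

End LowOrder.

(** * The sums [W] *)

Section SumW.
Variable p : nat.
Hypotheses (p_pr : prime p) (odd_p : odd p).
Let p_gt0 := prime_gt0 p_pr.
Let p_gt2 : (2 < p)%N := odd_prime_gt2 odd_p p_pr.
Local Notation Zp := (localized 'F_p).
Local Notation red := (smap (@residue 'F_p)).
Local Notation t := (ppowers 'F_p p).

Definition AHmod : series 'F_p := red (AHloc p_pr).

Lemma AHmodE n : AHmod n = AH_coef p n. Proof. by []. Qed.

Lemma theta_AHmod : theta AHmod = t * AHmod.
Proof. by rewrite /AHmod -smap_theta theta_AHloc rmorphM /= smap_ppowers. Qed.

(** The inverse of [AH (X)] is [AH (- X)], because [t] is an odd series. *)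
Lemma AHmod_norm : AHmod * sneg AHmod = 1.
Proof.
have u1 : (AH p : series rat) * sneg (AH p : series rat) = 1.
  apply: (@ODE_unique 0) => //.
  - by rewrite sM0E /sneg expr0 mul1r AH0 mulr1.
  - rewrite mul0r thetaM -sneg_theta theta_AH // snegM sneg_ppowers //; ring.
  - by rewrite theta1 mul0r.
have v1 : AHloc p_pr * sneg (AHloc p_pr) = 1.
  apply/funext => n; apply: val_inj; rewrite s1E rmorph_nat.
  have := congr1 (fun f : series rat => f n) u1; rewrite s1E => <-.
  rewrite !sME rmorph_sum; apply: eq_bigr => i _.
  by rewrite rmorphM /sneg rmorphM rmorph_sign.
have -> : sneg AHmod = red (sneg (AHloc p_pr)).
  by apply/funext => n; rewrite /smap /sneg rmorphM /= rmorph_sign.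
by rewrite /AHmod -rmorphM v1 rmorph1.
Qed.

Local Notation A := (block p 0 AHmod).

Lemma W_coef k : W p k = (sneg (theta A) * A) k.
Proof.
rewrite sME /W; apply: eq_bigr => r _.
by rewrite /sneg /theta /block !addn0 !AHmodE !mulrA.
Qed.

Lemma theta_A (K : {poly int}) (S : series Zp) :
    rising 1 p = 'X^(p.-1) - 1 + p%:R * K ->
    ppowers Zp p ^+ p - ppowers Zp p + mon Zp 1 = p%:R * S ->
  theta A = - (red S + t * ieval t K) * A.
Proof.
move=> eK eS; have [r er] := block0_ODE p_pr odd_p (theta_AHloc p_pr)
  (fun f g => @series_natZp_inj p p f g p_gt0) eK eS.
have two_unit : 2%:R != 0 :> 'F_p by rewrite natFp_eq0 // gtnNdvd.
have := congr1 red er; rewrite !(rmorphM, rmorphD, rmorph_nat) /=.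
rewrite nat_series_Fp // mul0r rmorph_ieval /= smap_ppowers smap_theta.
have -> : red (block p 0 (AHloc p_pr)) = A by [].
move=> e2; apply/eqP; rewrite -subr_eq0 mulNr opprK addrC; apply/eqP/funext => n.
have /eqP := congr1 (fun f : series _ => f n) e2.
by rewrite smul_natE mulf_eq0 (negPf two_unit) => /eqP.
Qed.

Lemma divided_power_exists : exists S : series Zp,
  ppowers Zp p ^+ p - ppowers Zp p + mon Zp 1 = p%:R * S.
Proof.
apply: series_residue_eq0 => //.
rewrite rmorphD rmorphB rmorphXn /= smap_ppowers smap_mon mon1_ppowers //.
by ring.
Qed.

Lemma divided_power_low (S : series Zp) n : (n < 3 * p)%N ->
    ppowers Zp p ^+ p - ppowers Zp p + mon Zp 1 = p%:R * S ->
  S n = (n == (2 * p).-1)%N%:R + (p.-1)./2%:R * (n == 3 * p - 2)%N%:R.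
Proof.
move=> lt_n eS; apply: (@natZp_inj p p) => //.
rewrite -smul_natE -eS !sDE sNE ppowersX_low // (ppowers_low Zp p_pr odd_p lt_n).
have -> : 'C(p, 2) = (p * (p.-1)./2)%N.
  by rewrite bin2 -[X in (p * X)./2](_ : (p.-1)./2.*2 = _) -?doubleMr ?doubleK //; lia.
rewrite sDE /mon natrM.
rewrite (_ : (n == p + p.-1)%N = (n == (2 * p).-1)%N); last by lia.
rewrite (_ : (n == p + 2 * p.-1)%N = (n == 3 * p - 2)%N); last by lia.
by ring.
Qed.

(** The two summands come from the two summands of [Y K (- t) -
    (1 - t^(p-1)) S (- Y)].  In the first one, a coefficient of [t^i] with
    [i <= p - 2] and index in the range [2 p - 1 .. 3 p - 2] can only come from
    two factors [Y^p] in [(Y + Y^p)^i], which forces [i = k - 2 p + 1]. *)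
Lemma W_formula (K : {poly int}) k :
    rising 1 p = 'X^(p.-1) - 1 + p%:R * K -> (size K <= p.-1)%N ->
    (2 * p <= k < 3 * p)%N ->
  W p k = 'C(k - 2 * p + 1, 2)%:R * (-1) ^+ (k - 2 * p + 1)
            * (K`_(k - 2 * p + 1))%:~R
          + ((p.-1)./2%:R - 1) * (k == 3 * p - 2)%N%:R.
Proof.
move=> eK sK /andP[le_2pk lt_k3p]; have [S eS] := divided_power_exists.
pose q := t ^+ p.-1.
have normA := norm_block0 p_pr odd_p theta_AHmod AHmod_norm.
have eW : sneg (theta A) * A = mon 'F_p 1 * ieval (- t) K - (1 - q) * sneg (red S).
  rewrite (theta_A eK eS) rmorphM rmorphN rmorphD rmorphM /=.
  rewrite rmorph_ieval /= sneg_ppowers // -mulrA [sneg _ * A]mulrC normA.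
  rewrite mon1_ppowers //; have -> : t ^+ p = t * q by rewrite -exprS prednK.
  by rewrite -/q; ring.
rewrite W_coef eW.
rewrite sDE sNE; set j := (k - 2 * p + 1)%N; congr (_ + _).
  have k_gt0 : (0 < k)%N by lia.
  rewrite monME k_gt0 (ievalE _ sK) sumsE.
  have term (i : 'I_p.-1) : ((K`_i)%:~R * (- t) ^+ i) (k - 1)%N
    = if (i == j :> nat) then 'C(j, 2)%:R * (-1) ^+ j * (K`_j)%:~R else 0.
    have lt_i := ltn_ord i.
    rewrite smul_intE [(- t) ^+ i]exprNn smul_signE ppowersX_low //; last lia.
    rewrite (_ : (k - 1 == i)%N = false); last by lia.
    rewrite (_ : (k - 1 == i + p.-1)%N = false); last by lia.
    rewrite (_ : (k - 1 == i + 2 * p.-1)%N = (i == j :> nat)); last by lia.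
    by case: eqP => [->|_]; rewrite ?mulr1 ?mulr0 !add0r ?mulr0 //; ring.
  rewrite (eq_bigr _ (fun i _ => term i)) -big_mkcond /=.
  have [lt_j | le_j] := ltnP j p.-1.
    by rewrite (big_pred1 (Ordinal lt_j)).
  rewrite [K`_j]nth_default ?mulr0 1?(leq_trans sK) // big_pred0 // => i.
  by have := ltn_ord i; lia.
have redS : eq_below (3 * p) (sneg (red S))
    (- (mon 'F_p (2 * p)%N.-1 + (p.-1)./2%:R * mon 'F_p (3 * p - 2)%N)).
  move=> n lt_n; rewrite /sneg /smap (divided_power_low lt_n eS).
  rewrite rmorphD rmorphM !rmorph_nat sNE sDE smul_natE /mon.
  have [en|ne] := eqVneq n (2 * p).-1.
    by rewrite -signr_odd (_ : odd n = true) ?expr1 ?mulN1r //; lia.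
  have [en|ne'] := eqVneq n (3 * p - 2)%N; last by rewrite !mulr0 addr0 mulr0 oppr0.
  by rewrite -signr_odd (_ : odd n = true) ?expr1 ?mulN1r //; lia.
rewrite (eq_belowM (fun _ _ => erefl) redS lt_k3p).
have -> : (1 - q) * - (mon 'F_p (2 * p)%N.-1 + (p.-1)./2%:R * mon 'F_p (3 * p - 2)%N)
  = mon 'F_p (2 * p)%N.-1 * q + (p.-1)./2%:R * (mon 'F_p (3 * p - 2)%N * q)
    - mon 'F_p (2 * p)%N.-1 - (p.-1)./2%:R * mon 'F_p (3 * p - 2)%N by ring.
rewrite !sDE !sNE !smul_natE !monME /mon.
rewrite (_ : (k == (2 * p).-1)%N = false); last by lia.
rewrite ifT /q; last by lia.
rewrite ppowersX_low //; last by lia.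
rewrite (_ : (k - (2 * p).-1 == p.-1)%N = (k == 3 * p - 2)%N); last by lia.
rewrite (_ : (k - (2 * p).-1 == p.-1 + p.-1)%N = false); last by lia.
rewrite (_ : (k - (2 * p).-1 == p.-1 + 2 * p.-1)%N = false); last by lia.
have -> : (if (3 * p - 2 <= k)%N then (t ^+ p.-1) (k - (3 * p - 2))%N else 0) = 0.
  case: ifP => // le_k; rewrite ppowersX_low //; last by lia.
  rewrite (_ : (k - (3 * p - 2) == p.-1)%N = false); last by lia.
  rewrite (_ : (k - (3 * p - 2) == p.-1 + p.-1)%N = false); last by lia.
  rewrite (_ : (k - (3 * p - 2) == p.-1 + 2 * p.-1)%N = false); last by lia.
  by rewrite !mulr0 !addr0.
by rewrite /=; ring.
Qed.

End SumW.

Theorem corollary1p6 (p k : nat) (p_prime : prime p)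
  (hp : p = 3%N \/ (5 <= p)%N) (hk : (2 * p <= k <= 3 * p - 1)%N) :
  [/\ (k <= 3 * p - 3)%N ->
        W p k = ((k - 2 * p)%:R * (k - 2 * p + 1)%:R)
                  / (2%:R * (k - 2 * p + 2)%:R)
                * redp p (bernoulli (3 * p - 2 - k)),
      k = (3 * p - 2)%N -> W p k = - (3%:R / 2%:R)
    & k = (3 * p - 1)%N -> W p k = 0].
Proof.
have p_gt2 : (2 < p)%N by case: hp => [->|]; lia.
have odd_p : odd p by case: (even_prime p_prime) p_gt2 => // ->.
have [K [eK sK]] := rising_wilson p_prime.
have lt_k : (2 * p <= k < 3 * p)%N by lia.
have two_unit : 2%:R != 0 :> 'F_p by rewrite natFp_eq0 // gtnNdvd.
have p0 := natFp_p p_prime.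
rewrite (W_formula p_prime odd_p eK sK lt_k); set j := (k - 2 * p + 1)%N.
split=> [le_k|ek|ek].
- rewrite (_ : (k == 3 * p - 2)%N = false) ?mulr0 ?addr0; last by lia.
  set m := (3 * p - 2 - k)%N.
  have m_int : (0 < m <= p - 2)%N by rewrite /m; lia.
  have nz_m : m%:R != 0 :> 'F_p by rewrite natFp_eq0 // gtnNdvd; lia.
  have [_ red_m] := bernoulli_reduces p_prime odd_p eK sK (andP m_int).2.
  have -> : redp p (bernoulli m) = - (-1) ^+ j * m%:R * (K`_j)%:~R.
    rewrite /redp red_m /scaled_coef (_ : (p.-1 - m = j)%N); last by rewrite /m /j; lia.
    have -> : (-1) ^+ m.-1 = - (-1) ^+ j :> 'F_p.
      rewrite -[RHS]mulN1r -exprS -signr_odd -[RHS]signr_odd.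
      by congr (_ ^+ nat_of_bool _); rewrite /m /j; lia.
    by case: (m) m_int.
  have -> : (k - 2 * p + 2)%:R = - m%:R :> 'F_p.
    rewrite (_ : k - 2 * p + 2 = p - m)%N; last by rewrite /m; lia.
    by rewrite natrB ?p0 ?sub0r //; lia.
  have bin2j : 'C(j, 2)%:R * 2%:R = (k - 2 * p)%:R * j%:R :> 'F_p.
    have ej : j.-1 = (k - 2 * p)%N by rewrite /j addn1.
    by rewrite -natrM mulnC -(mul_bin_diag j 1) bin1 ej natrM mulrC.
  have cancel (F : fieldType) (b c x y z : F) : b != 0 -> x != 0 ->
      c * y * z = c * b / (b * - x) * (- y * x * z).
    by move=> nz_b nz_x; field; rewrite nz_b oppr_eq0 nz_x.
  by rewrite -bin2j; apply: cancel.
- rewrite [K`_j]nth_default; last by apply: leq_trans sK _; rewrite /j; lia.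
  rewrite ek eqxx mulr0 add0r mulr1; apply: (mulIf two_unit).
  rewrite mulNr divfK // mulrBl -natrM muln2.
  rewrite (_ : (p.-1)./2.*2 = p - 1)%N; last by lia.
  by rewrite natrB ?p0; [ring|lia].
rewrite [K`_j]nth_default; last by apply: leq_trans sK _; rewrite /j; lia.
by rewrite (_ : (k == 3 * p - 2)%N = false) ?mulr0 ?addr0 //; lia.
Qed.
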